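(* For any composition $\boldsymbol{k}=(k_1,\ldots,k_r)$ and any $k\in\mathbb{N}_0$, with $n:=|\boldsymbol{k}|+1-\mathrm{dep}(\boldsymbol{k})$, $$\xi(k+1;\boldsymbol{k})=\sum_{\substack{\boldsymbol{j}\in\mathbb{N}_0^n\\ |\boldsymbol{j}|=k}}B\big((\overleftarrow{\boldsymbol{k}}^\vee)_+;\boldsymbol{j}\big)\,\zeta\big((\overleftarrow{\boldsymbol{k}}^\vee)_++\boldsymbol{j}\big),$$ $$\psi(k+1;\boldsymbol{k})=\sum_{\substack{\boldsymbol{j}\in\mathbb{N}_0^n\\ |\boldsymbol{j}|=k}}B\big((\overleftarrow{\boldsymbol{k}}^\vee)_+;\boldsymbol{j}\big)\,T\big((\overleftarrow{\boldsymbol{k}}^\vee)_++\boldsymbol{j}\big).$$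
   Context: $\mathbb{N}$ is the set of positive integers, $\mathbb{N}_0=\mathbb{N}\cup\{0\}$. A composition is a finite sequence $\boldsymbol{k}=(k_1,\ldots,k_r)\in\mathbb{N}^r$, $r\ge 1$; its weight is $|\boldsymbol{k}|=k_1+\cdots+k_r$ and its depth is $\mathrm{dep}(\boldsymbol{k})=r$ (also $|\boldsymbol{j}|$ is the sum of the entries for $\boldsymbol{j}\in\mathbb{N}_0^n$). The reversal is $\overleftarrow{\boldsymbol{k}}=(k_r,\ldots,k_1)$, and $\boldsymbol{k}_+=(k_1+1,k_2,\ldots,k_r)$. The Hoffman dual $\boldsymbol{k}^\vee=(k'_1,\ldots,k'_{r'})$ of $\boldsymbol{k}$ is the unique composition of the same weight such that $\{1,2,\ldots,|\boldsymbol{k}|-1\}$ is the disjoint union of $\{\sum_{i=1}^{j}k_i: 1\le j\le r-1\}$ and $\{\sum_{i=1}^{j}k'_i:1\le j\le r'-1\}$. The notation $\overleftarrow{\boldsymbol{k}}^\vee$ means $(\overleftarrow{\boldsymbol{k}})^\vee$; it has depth $n=|\boldsymbol{k}|+1-\mathrm{dep}(\boldsymbol{k})$. For $\boldsymbol{k}\in\mathbb{N}^r$ and $\boldsymbol{j}\in\mathbb{N}_0^r$, $\boldsymbol{k}+\boldsymbol{j}$ is the componentwise sum and $B(\boldsymbol{k};\boldsymbol{j})=\prod_{i=1}^r\binom{k_i+j_i-1}{j_i}$. For a composition with $k_1>1$, the multiple zeta value and multiple $T$-value are $$\zeta(\boldsymbol{k})=\sum_{n_1>\cdots>n_r>0}\frac{1}{n_1^{k_1}\cdots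 n_r^{k_r}},\qquad T(\boldsymbol{k})=\sum_{\substack{n_1>\cdots>n_r>0\\ n_j\equiv r+1-j\ (\mathrm{mod}\ 2)}}\frac{2^r}{n_1^{k_1}\cdots n_r^{k_r}}.$$ For $0\le x<1$, $$\mathrm{Li}_{\boldsymbol{k}}(x)=\sum_{n_1>\cdots>n_r>0}\frac{x^{n_1}}{n_1^{k_1}\cdots n_r^{k_r}},\qquad \mathrm{A}(\boldsymbol{k};x)=2^r\sum_{\substack{n_1>\cdots>n_r>0\\ n_j\equiv r+1-j\ (\mathrm{mod}\ 2)}}\frac{x^{n_1}}{n_1^{k_1}\cdots n_r^{k_r}}.$$ For $\Re(s)>0$ the Arakawa–Kaneko zeta function and the Kaneko–Tsumura $\psi$-function are $$\xi(s;\boldsymbol{k})=\frac{1}{\Gamma(s)}\int_0^\infty\frac{t^{s-1}}{e^t-1}\mathrm{Li}_{\boldsymbol{k}}(1-e^{-t})\,dt,\qquad \psi(s;\boldsymbol{k})=\frac{1}{\Gamma(s)}\int_0^\infty t^{s-1}\frac{\mathrm{A}(\boldsymbol{k};\tanh(t/2))}{\sinh(t)}\,dt.$$ *)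

(* Defs.v *)
From HB Require Import structures.
From mathcomp Require Import all_boot all_order all_algebra.
From mathcomp Require Import zify.
From mathcomp Require Import all_classical all_reals all_analysis.

Set Implicit Arguments.
Unset Strict Implicit.
Unset Printing Implicit Defensive.

Import Order.TTheory GRing.Theory Num.Theory.
Import numFieldNormedType.Exports.

Local Open Scope classical_set_scope.
Local Open Scope nat_scope.

(* A composition (k_1, ..., k_r) is the list [:: k_1; ...; k_r]; its weight is
   [sumn k], its depth [size k] and its reversal [rev k]. *)
Definition is_composition (k : seq nat) : bool :=
  (0 < size k) && all (fun i => 0 < i) k.

Definition comp_plus (k : seq nat) : seq nat :=
  if k is k1 :: k' then k1.+1 :: k' else [::].

Definition comp_add (k j : seq nat) : seq nat :=
  [seq p.1 + p.2 | p <- zip k j].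

Definition compB (k j : seq nat) : nat :=
  \prod_(p <- zip k j) 'C(p.1 + p.2 - 1, p.2).

(* The proper partial sums k_1 + ... + k_j, for 1 <= j <= r - 1. *)
Definition partial_sums (k : seq nat) : seq nat :=
  [seq sumn (take j k) | j <- iota 1 (size k).-1].

(* The increasing list of the elements of {1, ..., |k| - 1} that are not partial
   sums of k is the list of partial sums of the dual, whose entries are
   therefore the successive differences; see [hoffman_dualP] and
   [hoffman_dual_unique]. *)
Definition hoffman_dual (k : seq nat) : seq nat :=
  pairmap (fun a b => b - a) 0
    (rcons [seq m <- iota 1 (sumn k).-1 | m \notin partial_sums k] (sumn k)).

Lemma size_partial_sums k : size (partial_sums k) = (size k).-1.
Proof. by rewrite size_map size_iota. Qed.

Lemma partial_sums_scanl x k :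
  rcons (partial_sums (x :: k)) (sumn (x :: k)) = scanl addn 0 (x :: k).
Proof.
apply: (@eq_from_nth _ 0).
  by rewrite size_rcons size_partial_sums size_scanl.
move=> i; rewrite size_rcons size_partial_sums => lti.
rewrite nth_scanl // nth_rcons size_partial_sums.
have foldlE s a : foldl addn a s = a + sumn s.
  by elim: s a => [|y s IHs] a /=; rewrite ?addn0 // IHs addnA.
rewrite foldlE add0n; case: ltnP => [lt_i|le_i].
  by rewrite (nth_map 0) ?size_iota // nth_iota // add1n.
have -> : i = size k by move: lti le_i => /=; lia.
by rewrite eqxx take_oversize.
Qed.

Lemma comp_partial_sums x k :
  pairmap (fun a b => b - a) 0 (rcons (partial_sums (x :: k)) (sumn (x :: k)))
  = x :: k.
Proof. by rewrite partial_sums_scanl scanlK // => a b; rewrite addKn. Qed.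

Lemma scanl_diff a s :
  path ltn a s -> scanl addn a (pairmap (fun a b => b - a) a s) = s.
Proof.
elim: s a => [|y s IHs] a //= /andP[lt_ay ys].
by rewrite subnKC ?(ltnW lt_ay) // IHs.
Qed.

Lemma all_diff a s :
  path ltn a s -> all (fun i => 0 < i) (pairmap (fun a b => b - a) a s).
Proof.
by elim: s a => [|y s IHs] a //= /andP[lt_ay /IHs ->]; rewrite subn_gt0 lt_ay.
Qed.

Lemma path_scanl a k :
  all (fun i => 0 < i) k -> path ltn a (scanl addn a k).
Proof.
elim: k a => [|x k IHk] a //= /andP[x_gt0 k_gt0].
by rewrite IHk // andbT -[ltnLHS]addn0 ltn_add2l.
Qed.

Lemma sorted_partial_sums k :
  is_composition k -> path ltn 0 (rcons (partial_sums k) (sumn k)).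
Proof.
case: k => [|x k] // /andP[_ k_gt0].
by rewrite partial_sums_scanl; apply: path_scanl.
Qed.

Lemma mem_partial_sums k m :
  is_composition k -> m \in partial_sums k -> 0 < m < sumn k.
Proof.
move=> /sorted_partial_sums; rewrite rcons_path => /andP[Hp Hl] mk.
apply/andP; split.
  by move: Hp; rewrite (path_sortedE ltn_trans) => /andP[/allP/(_ _ mk)].
move: Hp Hl => /path_sorted.
elim/last_ind: (partial_sums k) mk => [|s y IHs] //.
rewrite mem_rcons inE last_rcons => /predU1P[->//|ms] Hs ltm.
apply: ltn_trans ltm; move: Hs.
by rewrite -rev_sorted rev_rcons /= (path_sortedE (fun _ _ _ a b => ltn_trans b a))
  => /andP[/allP/(_ m)]; rewrite mem_rev; move/(_ ms).
Qed.

Lemma dual_path k : is_composition k ->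
  path ltn 0
    (rcons [seq m <- iota 1 (sumn k).-1 | m \notin partial_sums k] (sumn k)).
Proof.
case: k => [|x k] // /andP[_ /= /andP[x_gt0 _]]; set S := partial_sums _.
have P : path ltn 0 (rcons (iota 1 (x + sumn k).-1) (x + sumn k)).
  have -> : rcons (iota 1 (x + sumn k).-1) (x + sumn k) = iota 1 (x + sumn k).
    have := iotaD 1 (x + sumn k).-1 1; rewrite addn1 prednK ?addn_gt0 ?x_gt0 //.
    by move=> ->; rewrite /= cats1 add1n prednK // addn_gt0 x_gt0.
  by have := iota_ltn_sorted 0 (x + sumn k).+1.
apply: (subseq_path ltn_trans _ P).
by rewrite -!cats1 cat_subseq ?filter_subseq.
Qed.

Lemma hoffman_dual_partial_sums k : is_composition k ->
  partial_sums (hoffman_dual k) =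
    [seq m <- iota 1 (sumn k).-1 | m \notin partial_sums k] /\
  sumn (hoffman_dual k) = sumn k.
Proof.
move=> /dual_path P; have := scanl_diff P; rewrite -/(hoffman_dual k).
case E: (hoffman_dual k) => [|y s]; first by case: [seq _ <- _ | _].
by rewrite -partial_sums_scanl => /rcons_inj/pair_equal_spec.
Qed.

Lemma hoffman_dual_comp k : is_composition k -> is_composition (hoffman_dual k).
Proof.
move=> /dual_path P; rewrite /is_composition all_diff // andbT.
by rewrite size_pairmap size_rcons.
Qed.

(* [iota] has no duplicates, so the last conjunct says that {1, ..., |k| - 1} is
   the disjoint union of the two sets of partial sums. *)
Lemma hoffman_dualP k : is_composition k ->
  [/\ is_composition (hoffman_dual k),
      sumn (hoffman_dual k) = sumn k &
      perm_eq (partial_sums k ++ partial_sums (hoffman_dual k))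
              (iota 1 (sumn k).-1)].
Proof.
move=> kc; have [Ep Es] := hoffman_dual_partial_sums kc.
split=> //; first exact: hoffman_dual_comp.
have Uk : uniq (partial_sums k).
  have := sorted_partial_sums kc; rewrite rcons_path => /andP[/path_sorted H _].
  exact: (sorted_uniq ltn_trans ltnn H).
apply: uniq_perm; rewrite ?iota_uniq //.
  rewrite cat_uniq Uk Ep filter_uniq ?iota_uniq // andbT /=.
  by apply/hasPn => m; rewrite mem_filter => /andP[].
move=> m; rewrite mem_cat Ep mem_filter.
case mk: (m \in partial_sums k) => //=.
by have := mem_partial_sums kc mk; rewrite mem_iota; lia.
Qed.

Lemma hoffman_dual_unique k k' : is_composition k -> is_composition k' ->
  sumn k' = sumn k ->
  perm_eq (partial_sums k ++ partial_sums k') (iota 1 (sumn k).-1) ->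
  k' = hoffman_dual k.
Proof.
move=> kc kc' Es Hp.
suff Ep : partial_sums k' =
    [seq m <- iota 1 (sumn k).-1 | m \notin partial_sums k].
  rewrite /hoffman_dual -Ep -Es; case: k' kc' {Es Hp Ep} => // x k' _.
  by rewrite comp_partial_sums.
have S s x : path ltn 0 (rcons s x) -> sorted ltn s.
  by rewrite rcons_path => /andP[/path_sorted].
apply: (irr_sorted_eq ltn_trans ltnn).
- exact: S (sorted_partial_sums kc').
- exact: S (dual_path kc).
move=> m; rewrite mem_filter -(perm_mem Hp) mem_cat.
have := iota_uniq 1 (sumn k).-1; rewrite -(perm_uniq Hp) cat_uniq.
case/and3P => _ /hasPn /(_ m) D _.
by case mk': (m \in partial_sums k'); [rewrite (D mk') orbT | rewrite orbF andNb].
Qed.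

Lemma size_hoffman_dual k : is_composition k ->
  size (hoffman_dual k) = (sumn k).+1 - size k.
Proof.
move=> kc; have [/andP[s_gt0 _] _ /perm_size] := hoffman_dualP kc.
rewrite size_cat !size_partial_sums size_iota.
have : 0 < sumn k /\ 0 < size k.
  by case: (k) kc => [|x l] // /andP[_ /= /andP[]]; lia.
move: s_gt0; lia.
Qed.

Local Open Scope ring_scope.

(* The index tuples n_1 > ... > n_r > 0 *)
Definition mzv_index (r : nat) : set (seq nat) :=
  [set n | [/\ size n = r, sorted [rel a b | (b < a)%N] n
             & all (fun i => (0 < i)%N) n]].

(* The congruence n_j = r + 1 - j (mod 2), 1 <= j <= r, reads
   n_(i+1) = r - i (mod 2) for the list index i = j - 1. *)
Definition mtv_index (r : nat) : set (seq nat) :=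
  [set n | mzv_index r n /\
    forall i, (i < r)%N -> nth 0%N n i = (r - i)%N %[mod 2]].

Definition mzv_term (R : realType) (k n : seq nat) : R :=
  \prod_(p <- zip n k) (p.1%:R ^+ p.2)^-1.

(* All the multiple series below have nonnegative terms on the domains where
   they are used, so they are unordered sums; [fine] reads off their real
   value. *)
Definition mzv (R : realType) (k : seq nat) : R :=
  fine (\esum_(n in mzv_index (size k)) (mzv_term R k n)%:E).

Definition mtv (R : realType) (k : seq nat) : R :=
  fine (\esum_(n in mtv_index (size k)) (2 ^+ size k * mzv_term R k n)%:E).

Definition polylog (R : realType) (k : seq nat) (x : R) : R :=
  fine (\esum_(n in mzv_index (size k)) (x ^+ head 0%N n * mzv_term R k n)%:E).

Definition polyA (R : realType) (k : seq nat) (x : R) : R :=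
  2 ^+ size k *
  fine (\esum_(n in mtv_index (size k)) (x ^+ head 0%N n * mzv_term R k n)%:E).

Definition sinh (R : realType) (t : R) : R := (expR t - expR (- t)) / 2.
Definition cosh (R : realType) (t : R) : R := (expR t + expR (- t)) / 2.
Definition tanh (R : realType) (t : R) : R := sinh t / cosh t.

(* The functions of s are given for real s > 0. *)
Definition Gamma (R : realType) (s : R) : R :=
  \int[lebesgue_measure]_(t in `]0, +oo[) (t `^ (s - 1) * expR (- t)).

Definition arakawa_kaneko_xi (R : realType) (s : R) (k : seq nat) : R :=
  (Gamma s)^-1 *
  \int[lebesgue_measure]_(t in `]0, +oo[)
    (t `^ (s - 1) / (expR t - 1) * polylog k (1 - expR (- t))).

Definition kaneko_tsumura_psi (R : realType) (s : R) (k : seq nat) : R :=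
  (Gamma s)^-1 *
  \int[lebesgue_measure]_(t in `]0, +oo[)
    (t `^ (s - 1) * (polyA k (tanh (t / 2)) / sinh t)).

(* Main.v *)
(* The two identities are the cases a = 1, x(t) = 1 - e^(-t) and a = 2,
   x(t) = tanh(t/2) of a single computation: in both cases x' = (1 - x^a)/a, so
   that a * (sum over d of x^(ad)) * x' = 1, and the kernel 1/(e^t - 1), resp.
   1/sinh t, is x'/x = a * (sum over d of e^(-(ad+1)t)). Expanding this kernel
   in powers e^(-Nt) and Li or A in powers x^n turns the integral into a sum
   over N and over n_1 > ... > n_r of the products
   C_k(N, n_1) / (n_1^k_1 ... n_r^k_r), with the connector
   C_i(N, n) = int_0^oo t^i/i! e^(-Nt) x(t)^n dt.
   Integration by parts reads
   N C_i(N, n) = C_(i-1)(N, n) + n int_0^oo t^i/i! e^(-Nt) x^(n-1) x' dt,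
   and the two geometric expansions write the last integral as a sum of
   C_i(M, n) over M > N, or make its sum over n > m equal to C_i(N, m). Each
   factor 1/n is thus traded for a factor 1/N, the chain of the N growing
   exactly when that of the n does not shrink: this is Hoffman duality. The
   binomial coefficients count the ways to distribute the exponent k of t over
   the factors 1/N. *)

Require Import Defs.
From HB Require Import structures.
From mathcomp Require Import all_boot all_order all_algebra.
From mathcomp Require Import all_classical all_reals all_analysis.
From mathcomp Require Import measurable_realfun.
From mathcomp Require Import ring lra zify.

Set Implicit Arguments.
Unset Strict Implicit.
Unset Printing Implicit Defensive.

Import Order.TTheory GRing.Theory Num.Theory.
Import numFieldNormedType.Exports.

Local Open Scope ring_scope.

(** * Nested sums with steps in 1 + a N *)

Section nested_sums.
Context {R : realType} (a : nat).
Local Open Scope ereal_scope.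
Implicit Types (g h : nat -> \bar R) (k : seq nat).

(** For [a] = 1 the sum runs over all n > b, for [a] = 2 over the n > b of parity opposite to b. The
    weight [a] on every step builds up the factor 2^r of T and A. *)
Definition step_sum g (b : nat) : \bar R :=
  \sum_(0 <= d <oo) a%:R%:E * g (b + (a * d).+1)%N.

(** The head of k is the exponent of the largest index, at which g is evaluated; b bounds the
    smallest index from below. *)
Fixpoint nested_sum k g (b : nat) : \bar R :=
  if k is k1 :: k' then
    nested_sum k' (step_sum (fun n => (n%:R ^- k1)%:E * g n)) b
  else g b.

Lemma step_sum_ge0 g b : (forall n, 0 <= g n) -> 0 <= step_sum g b.
Proof. by move=> g0; apply: nneseries_ge0 => d _ _; rewrite mule_ge0. Qed.

Lemma le_step_sum g h b : (forall n, (0 < n)%N -> 0 <= g n <= h n) ->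
  step_sum g b <= step_sum h b.
Proof.
move=> gh; apply: lee_nneseries => d _ => [_|].
  by rewrite mule_ge0//; case/andP: (gh (b + (a * d).+1)%N (ltn_addl _ (ltn0Sn _))).
by rewrite lee_wpmul2l//; case/andP: (gh (b + (a * d).+1)%N (ltn_addl _ (ltn0Sn _))).
Qed.

Lemma eq_step_sum g h b : (forall n, (0 < n)%N -> g n = h n) ->
  step_sum g b = step_sum h b.
Proof.
by move=> gh; apply: eq_eseriesr => d _; rewrite gh// addnS.
Qed.

Lemma step_sumZ (c : R) g b : (forall n, 0 <= g n) ->
  step_sum (fun n => c%:E * g n) b = c%:E * step_sum g b.
Proof.
move=> g0; rewrite -nneseriesZl => [|d _]; last by rewrite mule_ge0.
by apply: eq_eseriesr => d _; rewrite muleCA.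
Qed.

Lemma step_sumD g h b : (forall n, 0 <= g n) -> (forall n, 0 <= h n) ->
  step_sum (fun n => g n + h n) b = step_sum g b + step_sum h b.
Proof.
move=> g0 h0; rewrite -nneseriesD => [|d _ _|d _ _]; rewrite ?mule_ge0//.
by apply: eq_eseriesr => d _; rewrite ge0_muleDr.
Qed.

Lemma step_sum_series (f : nat -> nat -> \bar R) b : (forall d n, 0 <= f d n) ->
  step_sum (fun n => \sum_(0 <= d <oo) f d n) b =
  \sum_(0 <= d <oo) step_sum (f d) b.
Proof.
move=> f0; rewrite nneseries_interchange; last by move=> *; rewrite mule_ge0.
apply: eq_eseriesr => d _; rewrite nneseriesZl//.
Qed.

Lemma exprVn_ge0 (n m : nat) : 0 <= (n%:R ^- m : R)%:E.
Proof. by rewrite lee_fin invr_ge0 exprn_ge0. Qed.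
Local Hint Resolve exprVn_ge0 : core.

Lemma nested_sum_ge0 k g b : (forall n, 0 <= g n) -> 0 <= nested_sum k g b.
Proof.
elim: k g => [|k1 k IHk] g g0 //=; apply: IHk => n.
by apply: step_sum_ge0 => m; rewrite mule_ge0.
Qed.

Lemma le_nested_sum k g h b : (forall n, 0 <= g n <= h n) ->
  nested_sum k g b <= nested_sum k h b.
Proof.
elim: k g h => [|k1 k IHk] g h gh /=; first by case/andP: (gh b).
apply: IHk => n; rewrite step_sum_ge0 => [|m].
  apply: le_step_sum => m _; case/andP: (gh m) => g0 le_gh.
  by rewrite mule_ge0//= lee_wpmul2l.
by rewrite mule_ge0//; case/andP: (gh m).
Qed.

Lemma eq_nested_sum k g h b : (forall n, g n = h n) ->
  nested_sum k g b = nested_sum k h b.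
Proof. by move=> /funext->. Qed.

Lemma eq_nested_sum_gt0 (k1 : nat) k g h b : (forall n, (0 < n)%N -> g n = h n) ->
  nested_sum (k1 :: k) g b = nested_sum (k1 :: k) h b.
Proof.
by move=> gh /=; apply: eq_nested_sum => n; apply: eq_step_sum => m m0; rewrite gh.
Qed.

Lemma nested_sumZ k (c : R) g b : (0 <= c)%R -> (forall n, 0 <= g n) ->
  nested_sum k (fun n => c%:E * g n) b = c%:E * nested_sum k g b.
Proof.
move=> c0; elim: k g => [|k1 k IHk] g g0 //=.
rewrite -IHk => [|n]; last by apply: step_sum_ge0 => m; rewrite mule_ge0.
apply: eq_nested_sum => n; rewrite -step_sumZ => [|m]; last by rewrite mule_ge0.
by apply: eq_step_sum => m _; rewrite muleCA.
Qed.

Lemma nested_sumD k g h b : (forall n, 0 <= g n) -> (forall n, 0 <= h n) ->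
  nested_sum k (fun n => g n + h n) b = nested_sum k g b + nested_sum k h b.
Proof.
elim: k g h => [|k1 k IHk] g h g0 h0 //=.
rewrite -IHk => [|n|n]; [|by apply: step_sum_ge0 => m; rewrite mule_ge0..].
apply: eq_nested_sum => n; rewrite -step_sumD => [|m|m]; [|by rewrite mule_ge0..].
by apply: eq_step_sum => m _; rewrite ge0_muleDr.
Qed.

Lemma nested_sum_series k (f : nat -> nat -> \bar R) b :
  (forall d n, 0 <= f d n) ->
  nested_sum k (fun n => \sum_(0 <= d <oo) f d n) b =
  \sum_(0 <= d <oo) nested_sum k (f d) b.
Proof.
elim: k f => [|k1 k IHk] f f0 //=.
rewrite -IHk => [|d n]; last by apply: step_sum_ge0 => m; rewrite mule_ge0.
apply: eq_nested_sum => n; rewrite -step_sum_series => [|d m]; last by rewrite mule_ge0.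
by apply: eq_step_sum => m _; rewrite nneseriesZl.
Qed.

(** Tonelli for nonnegative terms: the sum over the indices M of the second chain passes outside the
    chain of the n. *)
Lemma nested_sum_step_sum k (f : nat -> nat -> \bar R) b N :
  (forall M n, 0 <= f M n) ->
  nested_sum k (fun n => step_sum (f ^~ n) N) b =
  step_sum (fun M => nested_sum k (f M) b) N.
Proof.
move=> f0; rewrite nested_sum_series => [|d n]; last by rewrite mule_ge0.
by apply: eq_eseriesr => d _; rewrite nested_sumZ.
Qed.

Lemma nested_sum_rcons k m g b :
  nested_sum (rcons k m) g b =
  step_sum (fun n => (n%:R ^- m)%:E * nested_sum k g n) b.
Proof. by elim: k g => [|k1 k IHk] g //=; rewrite IHk. Qed.

Lemma nested_sumS (k1 : nat) k g b :
  nested_sum (k1.+1 :: k) g b =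
  nested_sum (k1 :: k) (fun n => (n%:R^-1)%:E * g n) b.
Proof.
rewrite /=; apply: eq_nested_sum => n; apply: eq_step_sum => m _.
by rewrite muleA -EFinM exprSr invfM mulrC.
Qed.

(** All summation indices are at least 1, so each exponent may be lowered to 1. Convergence is
    thereby reduced to the composition (1, ..., 1). *)
Lemma le_nested_sum_ones k g b : all (fun i => (0 < i)%N) k ->
  (forall n, 0 <= g n) ->
  nested_sum k g b <= nested_sum (nseq (size k) 1%N) g b.
Proof.
elim: k g => [|k1 k IHk] g //= /andP[k1_gt0 k_gt0] g0.
apply: le_trans (IHk _ k_gt0 _) _ => [n|].
  by apply: step_sum_ge0 => m; rewrite mule_ge0.
apply: le_nested_sum => n; rewrite step_sum_ge0 => [|m]; last by rewrite mule_ge0.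
apply: le_step_sum => m m0; rewrite mule_ge0//= lee_wpmul2r// lee_fin.
rewrite lef_pV2 ?posrE ?exprn_gt0 ?ltr0n//.
by rewrite ler_weXn2l// ler1n.
Qed.

Lemma emeasurable_step_sum d (T : measurableType d) (D : set T)
    (f : nat -> T -> \bar R) b :
  (forall n t, D t -> 0 <= f n t) -> (forall n, measurable_fun D (f n)) ->
  measurable_fun D (fun t => step_sum (f ^~ t) b).
Proof.
move=> f0 mf.
apply: (@ge0_emeasurable_sum _ _ R D
  (fun d t => a%:R%:E * f (b + (a * d).+1)%N t) xpredT) => [n t Dt _|n _].
  by rewrite mule_ge0// f0.
by apply: measurable_funeM.
Qed.

Lemma emeasurable_nested_sum d (T : measurableType d) (D : set T) k
    (f : nat -> T -> \bar R) b :
  (forall n t, D t -> 0 <= f n t) -> (forall n, measurable_fun D (f n)) ->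
  measurable_fun D (fun t => nested_sum k (f ^~ t) b).
Proof.
elim: k f => [|k1 k IHk] f f0 mf //=.
pose f' (n : nat) t := (n%:R ^- k1)%:E * f n t.
have f'0 n t : D t -> 0 <= f' n t by move=> Dt; rewrite mule_ge0// f0.
apply: (IHk (fun n t => step_sum (f' ^~ t) n)) => [n t Dt|n].
  by apply: step_sum_ge0 => m; exact: f'0.
by apply: emeasurable_step_sum => // m; exact: measurable_funeM.
Qed.

Lemma integral_step_sum d (T : measurableType d) (mu : {measure set T -> \bar R})
    (D : set T) (f : nat -> T -> \bar R) b : measurable D ->
  (forall n t, D t -> 0 <= f n t) -> (forall n, measurable_fun D (f n)) ->
  \int[mu]_(t in D) step_sum (f ^~ t) b =
  step_sum (fun n => \int[mu]_(t in D) f n t) b.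
Proof.
move=> mD f0 mf; rewrite integral_nneseries// => [|n|n t Dt].
- by apply: eq_eseriesr => n _; rewrite ge0_integralZl_EFin// => t Dt; exact: f0.
- exact: measurable_funeM.
- by rewrite mule_ge0// f0.
Qed.

Lemma integral_nested_sum d (T : measurableType d)
    (mu : {measure set T -> \bar R}) (D : set T) k
    (f : nat -> T -> \bar R) b : measurable D ->
  (forall n t, D t -> 0 <= f n t) -> (forall n, measurable_fun D (f n)) ->
  \int[mu]_(t in D) nested_sum k (f ^~ t) b =
  nested_sum k (fun n => \int[mu]_(t in D) f n t) b.
Proof.
move=> mD; elim: k f => [|k1 k IHk] f f0 mf //=.
pose f' (n : nat) t := (n%:R ^- k1)%:E * f n t.
have f'0 n t : D t -> 0 <= f' n t by move=> Dt; rewrite mule_ge0// f0.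
have mf' n : measurable_fun D (f' n) by exact: measurable_funeM.
rewrite (IHk (fun n t => step_sum (f' ^~ t) n)) => [|n t Dt|n].
- apply: eq_nested_sum => n; rewrite integral_step_sum//.
  apply: eq_step_sum => m _; rewrite ge0_integralZl_EFin// => t Dt.
  exact: f0.
- by apply: step_sum_ge0 => m; exact: f'0.
- exact: emeasurable_step_sum.
Qed.

End nested_sums.

(** * Integration over the half-line *)

Section halfline.
Context {R : realType}.
Notation mu := (@lebesgue_measure R).
Local Open Scope ereal_scope.
Local Open Scope classical_set_scope.

Lemma continuous_measurable_EFin (f : R -> R) (D : set R) :
  continuous f -> measurable_fun D (fun t => (f t)%:E).
Proof.
move=> cf; apply/measurable_EFinP; apply: measurable_funTS.
exact: continuous_measurable_fun.
Qed.

Lemma integral_halfline_cvg (f : R -> R) :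
  continuous f -> (forall t, (0 <= t)%R -> (0 <= f t)%R) ->
  \int[mu]_(t in `[0%R, n.+1%:R]) (f t)%:E @[n --> \oo] -->
  \int[mu]_(t in `]0%R, +oo[) (f t)%:E.
Proof.
move=> cf f0.
have mf : measurable_fun setT f by exact: continuous_measurable_fun.
rewrite integral_itv_obnd_cbnd; last first.
  by apply/measurable_EFinP; exact: measurable_funTS.
(* Monotone convergence is applied to |f|, which is nonnegative everywhere and agrees with f for t
   >= 0. *)
have E (D : set R) : D `<=` [set t | (0 <= t)%R] ->
    \int[mu]_(t in D) (f t)%:E = \int[mu]_(t in D) `|f t|%:E.
  by move=> D0; apply: eq_integral => t /[!inE] /D0 t0; rewrite ger0_norm ?f0.
rewrite E => [|t /=]; last by rewrite in_itv/= andbT.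
under eq_cvg => n.
  rewrite E => [|t /=]; last by rewrite in_itv/= => /andP[].
  over.
have := @ge0_cvgn_integral R mu (fun t => `|f t|%R) (fun=> normr_ge0 _).
rewrite -cvg_shiftS/=; apply; exact: measurableT_comp.
Qed.

(** On [0, n + 1] the integral of g - f is F(n + 1) - F(0); then n tends to infinity. Splitting the
    derivative into nonnegative parts f and g gives both half-line integrals a meaning in the
    extended reals without assuming integrability. *)
Lemma FTC2_halfline (F f g : R -> R) :
  continuous f -> continuous g ->
  (forall t, (0 <= t)%R -> (0 <= f t)%R) ->
  (forall t, (0 <= t)%R -> (0 <= g t)%R) ->
  (forall t : R, is_derive t 1%R F (g t - f t)%R) ->
  F n%:R @[n --> \oo] --> (0%R : R) ->
  \int[mu]_(t in `]0%R, +oo[) (f t)%:E =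
  (F 0%R)%:E + \int[mu]_(t in `]0%R, +oo[) (g t)%:E.
Proof.
move=> cf cg f0 g0 dF Foo.
have int n (h : R -> R) : continuous h ->
    mu.-integrable `[0%R, n.+1%:R] (EFin \o h).
  move=> ch; apply: continuous_compact_integrable; first exact: segment_compact.
  exact: continuous_subspaceT.
have fE n : \int[mu]_(t in `[0%R, n.+1%:R]) (f t)%:E =
    \int[mu]_(t in `[0%R, n.+1%:R]) (g t)%:E + (F 0%R - F n.+1%:R)%:E.
  have : \int[mu]_(t in `[0%R, n.+1%:R]) (g t - f t)%:E = (F n.+1%:R)%:E - (F 0%R)%:E.
    apply: continuous_FTC2; rewrite ?ltr0n//.
    - apply: continuous_subspaceT => t; apply: cvgB; [exact: cg|exact: cf].
    - have cF t : {for t, continuous F}.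
        apply: differentiable_continuous; apply/derivable1_diffP.
        by have := dF t => /@ex_derive.
      split => [t _|/=|/=].
      + by have := dF t => /@ex_derive.
      + exact: cvg_at_right_filter (cF _).
      + exact: cvg_at_left_filter (cF _).
    - by move=> t _; rewrite derive1E; have := dF t => /@derive_val.
  under eq_integral do rewrite EFinB.
  rewrite integralB//; [|exact: int..].
  have /integrable_fin_num : mu.-integrable `[0%R, n.+1%:R] (EFin \o g) by exact: int.
  have /integrable_fin_num : mu.-integrable `[0%R, n.+1%:R] (EFin \o f) by exact: int.
  move=> /(_ (measurable_itv _)) + /(_ (measurable_itv _)).
  rewrite /comp; do 2 case: (\int[_]_(_ in _) _) => //.
  by move=> u v _ _; rewrite -!EFinB -EFinD => -[e]; congr EFin; lra.
have := integral_halfline_cvg cf f0.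
under eq_cvg do rewrite fE.
move=> H; apply: (cvg_unique _ H) => //; rewrite addeC; apply: cvgeD => //.
- by rewrite fin_num_adde_defl.
- exact: integral_halfline_cvg.
- apply: cvg_EFin; first by near=> n.
  rewrite -[X in _ --> X]subr0; apply: cvgB; first exact: cvg_cst.
  by rewrite (cvg_shiftS (fun n => F n%:R)).
Unshelve. all: by end_near. Qed.

End halfline.

(** * The connector *)

Section geometric.
Context {R : realType}.
Local Open Scope ereal_scope.

Lemma eseries_geometric (c q : R) : (0 <= q < 1)%R ->
  \sum_(0 <= d <oo) (c * q ^+ d)%:E = (c / (1 - q))%:E.
Proof.
move=> /andP[q0 q1]; apply/cvg_lim => //.
under eq_cvg do rewrite sumEFin.
apply: cvg_EFin; first exact: nearW.
by apply: cvg_geometric_series; rewrite ger0_norm.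
Qed.

Lemma step_sum_geometric (a : nat) (c q : R) (b : nat) :
  (0 < a)%N -> (0 <= q < 1)%R ->
  step_sum a (fun n => (c * q ^+ n)%:E) b =
  (c * a%:R * q ^+ b.+1 / (1 - q ^+ a))%:E.
Proof.
move=> a0 /andP[q0 q1]; rewrite -eseries_geometric; last first.
  by rewrite exprn_ge0//= exprn_ilt1// -lt0n.
apply: eq_eseriesr => d _; rewrite -EFinM -addSnnS exprD exprM.
by congr EFin; ring.
Qed.

End geometric.

Section connector.
Context {R : realType} (a : nat) (x : R -> R).
Notation mu := (@lebesgue_measure R).
Local Open Scope classical_set_scope.

(** The factor 1/i! makes differentiation of the power lower i without a coefficient; for N > 0 the
    integral over the half-line is N^-(i+1). *)
Definition gamma_kernel (i N : nat) (t : R) : R :=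
  t ^+ i / i`!%:R * expR (- t) ^+ N.

(* The substitution z = x(t) in the iterated integrals: the third clause gives
   a * (sum over d of x^(a d)) * x' = 1, and the last one says that x' / x is
   a * (sum over d of expR (- (a d + 1) t)). *)
Definition dualizing : Prop :=
  [/\ (0 < a)%N, x 0 = 0,
      forall t : R, is_derive t 1 x ((1 - x t ^+ a) / a%:R),
      forall t : R, 0 < t -> 0 < x t < 1 &
      forall t : R, 0 < t ->
        x t * (a%:R * expR (- t) / (1 - expR (- t) ^+ a)) =
        (1 - x t ^+ a) / a%:R].

Definition connector (i N n : nat) : \bar R :=
  \int[mu]_(t in `]0%R, +oo[) (gamma_kernel i N t * x t ^+ n)%:E.

(* By the last clause of [dualizing], the integrand of [connector' i N n] is
   that of [connector i N n.+1] times x' / x. *)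
Definition connector' (i N n : nat) : \bar R :=
  \int[mu]_(t in `]0%R, +oo[)
    (gamma_kernel i N t * x t ^+ n * ((1 - x t ^+ a) / a%:R))%:E.

Context (xP : dualizing).

Let a0 : (0 < a)%N. Proof. by case: xP. Qed.
Let x0 : x 0 = 0. Proof. by case: xP. Qed.
Let dx t : is_derive (t : R) 1 x ((1 - x t ^+ a) / a%:R).
Proof. by case: xP. Qed.
Let x01 t : 0 < t -> 0 < x t < 1. Proof. by case: xP => _ _ _ + _; exact. Qed.

Let a_gt0 : 0 < a%:R :> R. Proof. by rewrite ltr0n. Qed.

Lemma dualizing_ge0 t : 0 <= t -> 0 <= x t < 1.
Proof.
by rewrite le_eqVlt => /predU1P[<-|/x01/andP[/ltW-> ->]]//; rewrite x0 lexx ltr01.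
Qed.

Let dx_ge0 t : 0 <= t -> 0 <= (1 - x t ^+ a) / a%:R.
Proof.
move=> /dualizing_ge0/andP[x_ge0 /ltW x_le1].
by rewrite divr_ge0// subr_ge0 exprn_ile1.
Qed.

Lemma gamma_kernel_ge0 i N t : 0 <= t -> 0 <= gamma_kernel i N t.
Proof.
by move=> t0; rewrite mulr_ge0 ?divr_ge0 ?exprn_ge0 ?expR_ge0.
Qed.

Lemma is_derive_gamma_kernel i N (t : R) :
  is_derive t 1 (gamma_kernel i N)
    ((if i is i'.+1 then gamma_kernel i' N t else 0)
     - N%:R * gamma_kernel i N t).
Proof.
have -> : gamma_kernel i N =
    ((i`!%:R^-1 : R) *: (id : R -> R) ^+ i) * (expR \o (-%R : R -> R)) ^+ N.
  by apply/funext => u; rewrite /gamma_kernel !fctE /GRing.scale/= [_^-1 * _]mulrC.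
apply: is_derive_eq; rewrite !fctE /GRing.scale/= /gamma_kernel.
have fact_neq0 m : m`!%:R != 0 :> R by rewrite pnatr_eq0 -lt0n fact_gt0.
(* The derivatives of the two powers contain [i.-1] and [N.-1], so zero exponents are treated
   apart. *)
case: i => [|i]; case: N => [|N] /=; rewrite ?fact0 ?factS ?natrM ?exprS;
  field; rewrite ?fact_neq0 ?natr1 ?nat1r ?pnatr_eq0//.
Qed.

Lemma continuous_is_derive (f : R -> R) (df : R -> R) :
  (forall t : R, is_derive t 1 f (df t)) -> continuous f.
Proof.
move=> fP t; apply: differentiable_continuous; apply/derivable1_diffP.
by have := fP t => /@ex_derive.
Qed.

Let cx : continuous x. Proof. exact: continuous_is_derive dx. Qed.

Lemma continuous_gamma_kernel i N : continuous (gamma_kernel i N).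
Proof. exact: continuous_is_derive (is_derive_gamma_kernel i N). Qed.

Let continuousX (f : R -> R) n : continuous f -> continuous (fun t => f t ^+ n).
Proof.
move=> cf t; apply: (@continuous_comp _ _ _ f (fun u => u ^+ n)); first exact: cf.
exact: exprn_continuous.
Qed.

Lemma continuous_dualizingX n : continuous (fun t => x t ^+ n).
Proof. exact: continuousX. Qed.

Lemma continuous_integrand i N n : continuous (fun t => gamma_kernel i N t * x t ^+ n).
Proof.
move=> t; apply: cvgM; first exact: continuous_gamma_kernel.
exact: continuousX.
Qed.

Let continuous_integrand' i N n :
  continuous (fun t => gamma_kernel i N t * x t ^+ n * ((1 - x t ^+ a) / a%:R)).
Proof.
move=> t; apply: cvgM; first exact: continuous_integrand.
by apply: cvgM; [apply: cvgB; [exact: cvg_cst|exact: continuousX]|exact: cvg_cst].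
Qed.

Let integrand_ge0 i N n t : 0 <= t -> 0 <= gamma_kernel i N t * x t ^+ n.
Proof.
move=> t0; rewrite mulr_ge0 ?gamma_kernel_ge0// exprn_ge0//.
by case/andP: (dualizing_ge0 t0).
Qed.

Let integrand'_ge0 i N n t : 0 <= t ->
  0 <= gamma_kernel i N t * x t ^+ n * ((1 - x t ^+ a) / a%:R).
Proof. by move=> t0; rewrite mulr_ge0 ?integrand_ge0 ?dx_ge0. Qed.

Lemma connector_ge0 i N n : (0 <= connector i N n)%E.
Proof.
apply: integral_ge0 => t /=; rewrite in_itv/= andbT => /ltW t0.
by rewrite lee_fin integrand_ge0.
Qed.

Lemma connector'_ge0 i N n : (0 <= connector' i N n)%E.
Proof.
apply: integral_ge0 => t /=; rewrite in_itv/= andbT => /ltW t0.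
by rewrite lee_fin integrand'_ge0.
Qed.

(** Since x <= 1 and e^(-Nt) <= e^(-t), the bound e^t >= t^(i+1)/(i+1)! leaves at most (i+1)/t. *)
Lemma gamma_kernel_cvg0 i N n : (0 < N)%N ->
  gamma_kernel i N m%:R * x m%:R ^+ n @[m --> \oo] --> 0.
Proof.
move=> N0; rewrite -cvg_shiftS/=.
apply: (@squeeze_cvgr _ _ _ _ (fun=> 0) (fun m => i.+1%:R * m.+1%:R^-1)).
- apply: nearW => m; rewrite integrand_ge0//=.
  have m0 : 0 <= m.+1%:R :> R by [].
  have /andP[x_ge0 /ltW x_le1] := dualizing_ge0 m0.
  apply: (@le_trans _ _ (gamma_kernel i 1 m.+1%:R)).
    apply: (@le_trans _ _ (gamma_kernel i N m.+1%:R)).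
      by rewrite ler_piMr ?gamma_kernel_ge0 ?exprn_ile1.
    rewrite ler_wpM2l//.
    rewrite expr1 -[leRHS]expr1; apply: ler_wiXn2l => //; rewrite ?expR_ge0.
  rewrite /gamma_kernel expr1 expRN -ler_pdivlMr ?invr_gt0 ?expR_gt0// invrK.
  have := expR_ge1Dxn i m0; set e := expR _ => ee.
  rewrite mulrAC ler_pdivlMr ?ltr0n//.
  have f0 : 0 < i.+1`!%:R :> R by rewrite ltr0n fact_gt0.
  have := le_trans (ler_wpDl ler01 (lexx _)) ee.
  rewrite ler_pdivrMr// factS natrM exprS => ee'.
  rewrite mulrAC ler_pdivrMr ?ltr0n ?fact_gt0//.
  lra.
- exact: cvg_cst.
- rewrite -[X in _ --> X](mulr0 i.+1%:R); apply: cvgM; first exact: cvg_cst.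
  exact: cvg_harmonic.
Qed.

(** Integration by parts for F = t^i/i! e^(-Nt) x^n, which vanishes at infinity. As x(0) = 0, the
    boundary value F(0) is 1 if i = n = 0 and 0 otherwise, whence the term [n == 0]. *)
Lemma connector_parts i N n : (0 < N)%N ->
  connector i N n = ((N%:R^-1)%:E *
    ((if i is i'.+1 then connector i' N n else (n == 0%N)%:R%:E)
     + n%:R%:E * connector' i N n.-1))%E.
Proof.
move=> N0; have N_gt0 : 0 < N%:R :> R by rewrite ltr0n.
pose p t := if i is i'.+1 then gamma_kernel i' N t else 0.
pose F t := gamma_kernel i N t * x t ^+ n.
have cp : continuous (fun t => p t * x t ^+ n).
  rewrite /p; case: (i) => [|i']; last exact: continuous_integrand.
  by move=> t; apply: cvgM; [exact: cvg_cst|exact: continuousX].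
have p0 t : 0 <= t -> 0 <= p t * x t ^+ n.
  by rewrite /p; case: (i) => [|i'] t0; rewrite ?mul0r// integrand_ge0.
(* For n = 0 the truncated [n.-1] is multiplied by 0. *)
pose q t := n%:R * (gamma_kernel i N t * x t ^+ n.-1 * ((1 - x t ^+ a) / a%:R)).
have cq : continuous q.
  by move=> t; apply: cvgM; [exact: cvg_cst|exact: continuous_integrand'].
have q0 t : 0 <= t -> 0 <= q t by move=> t0; rewrite mulr_ge0 ?integrand'_ge0.
have := @FTC2_halfline R F (fun t => N%:R * F t) (fun t => p t * x t ^+ n + q t).
have -> : (\int[mu]_(t in `]0%R, +oo[) (N%:R * F t)%:E = N%:R%:E * connector i N n)%E.
  under eq_integral do rewrite EFinM.
  rewrite ge0_integralZl_EFin//; last first.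
    by apply: continuous_measurable_EFin; exact: continuous_integrand.
  by move=> t /=; rewrite in_itv/= andbT => /ltW t0; rewrite lee_fin integrand_ge0.
have -> : (\int[mu]_(t in `]0%R, +oo[) (p t * x t ^+ n + q t)%:E =
    \int[mu]_(t in `]0%R, +oo[) (p t * x t ^+ n)%:E + n%:R%:E * connector' i N n.-1)%E.
  under eq_integral do rewrite EFinD.
  have itv0 t : `]0%R, +oo[ t -> 0 <= t by rewrite /= in_itv/= andbT => /ltW.
  rewrite ge0_integralD//=; [|by move=> t /itv0 t0; rewrite lee_fin ?p0 ?q0
    |exact: continuous_measurable_EFin
    |by move=> t /itv0 t0; rewrite lee_fin ?p0 ?q0
    |exact: continuous_measurable_EFin].
  congr (_ + _)%E; under eq_integral do rewrite EFinM.
  rewrite ge0_integralZl_EFin//; last first.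
    by apply: continuous_measurable_EFin; exact: continuous_integrand'.
  by move=> t /itv0 t0; rewrite lee_fin integrand'_ge0.
have cF : continuous (fun t => N%:R * F t).
  by move=> t; apply: cvgM; [exact: cvg_cst|exact: continuous_integrand].
have F0 t : 0 <= t -> 0 <= N%:R * F t by move=> t0; rewrite mulr_ge0 ?integrand_ge0.
have cpq : continuous (fun t => p t * x t ^+ n + q t).
  by move=> t; apply: cvgD; [exact: cp|exact: cq].
have pq0 t : 0 <= t -> 0 <= p t * x t ^+ n + q t.
  by move=> t0; rewrite addr_ge0 ?p0 ?q0.
have dF : forall t : R, is_derive t 1 F (p t * x t ^+ n + q t - N%:R * F t).
  move=> t; rewrite (_ : F = gamma_kernel i N * x ^+ n); last first.
    by apply/funext => u; rewrite /F !fctE.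
  have gP := is_derive_gamma_kernel i N t; have xP' := dx t.
  apply: is_derive_eq; rewrite !fctE /GRing.scale/= /q /F.
  by rewrite -/(p t); ring.
move=> /(_ cF cpq F0 pq0 dF (gamma_kernel_cvg0 i n N0)) H.
have -> : connector i N n = ((N%:R^-1)%:E * (N%:R%:E * connector i N n))%E.
  by rewrite muleA -EFinM mulVf ?mul1e// gt_eqF.
congr (_ * _)%E; rewrite {}H addeA; congr (_ + _)%E.
rewrite /F /p x0 /gamma_kernel !expr0n oppr0 expR0 expr1n.
case: (i) => [|i'] /=; last by rewrite !mul0r add0e.
rewrite fact0 divr1 !mul1r integral0_eq ?adde0// => t _.
by rewrite mul0r.
Qed.

Let itv_gt0 (t : R) : `]0%R, +oo[ t -> 0 < t. Proof. by rewrite /= in_itv/= andbT. Qed.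

(** Pointwise, summing [a] e^(-Mt) over M in N + 1 + [a] N_0 gives e^(-Nt) x'/x, and the division by
    x lowers the exponent n + 1 to n. *)
Lemma step_sum_connector i N n :
  (step_sum a (fun M => connector i M n.+1) N = connector' i N n)%E.
Proof.
rewrite -integral_step_sum//; last 2 first.
- by move=> M t /itv_gt0/ltW t0; rewrite lee_fin integrand_ge0.
- move=> M; apply: continuous_measurable_EFin.
  exact: continuous_integrand.
apply: eq_integral => t /[!inE] /itv_gt0 t0.
have e01 : 0 <= expR (- t) < 1 by rewrite expR_ge0 -expR0 ltr_expR oppr_lt0.
have := step_sum_geometric (t ^+ i / i`!%:R * x t ^+ n.+1) N a0 e01.
have -> : (fun M => (t ^+ i / i`!%:R * x t ^+ n.+1 * expR (- t) ^+ M)%:E) =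
    (fun M => (gamma_kernel i M t * x t ^+ n.+1)%:E).
  by apply/funext => M; rewrite mulrAC.
move=> ->; congr EFin; case: xP => _ _ _ _ /(_ t t0) <-.
by rewrite /gamma_kernel !exprS; ring.
Qed.

(** Pointwise, summing [a] x^(m-1) x' over m in n + 1 + [a] N_0 gives x^n. *)
Lemma step_sum_connector' i N n :
  (step_sum a (fun m => connector' i N m.-1) n = connector i N n)%E.
Proof.
pose f m t : \bar R :=
  (gamma_kernel i N t * x t ^+ m.-1 * ((1 - x t ^+ a) / a%:R))%:E.
have f0 (m : nat) t : `]0%R, +oo[ t -> (0 <= f m t)%E.
  by move=> /itv_gt0/ltW t0; rewrite lee_fin integrand'_ge0.
have mf m : measurable_fun (`]0%R, +oo[ : set R) (f m).
  by apply: continuous_measurable_EFin; exact: continuous_integrand'.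
apply: etrans (esym (integral_step_sum a mu n (measurable_itv _) f0 mf)) _.
apply: eq_integral => t /[!inE] /itv_gt0 t0.
have /andP[xt0 xt1] := x01 t0.
have xt01 : 0 <= x t < 1 by rewrite xt1 ltW.
have xa : 0 < 1 - x t ^+ a by rewrite subr_gt0 exprn_ilt1 ?ltW// -lt0n.
(* The coefficient contains 1/x so that x^(m-1) becomes x^m/x; all m in the sum are positive. *)
have := step_sum_geometric
  (gamma_kernel i N t * ((1 - x t ^+ a) / a%:R) / x t) n a0 xt01.
rewrite [X in _ = X%:E -> _](_ : _ = gamma_kernel i N t * x t ^+ n); last first.
  by rewrite exprS; field; rewrite !gt_eqF.
move=> <-; apply: eq_step_sum => -[//|m] _; rewrite /f; congr EFin.
by rewrite exprS/=; field; rewrite !gt_eqF.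
Qed.

End connector.

(** * Connected sums and their recurrences *)

Section connected_sum.
Context {R : realType} (a : nat) (x : R -> R) (xP : dualizing a x).
Local Open Scope ereal_scope.
Notation mu := (@lebesgue_measure R).

(** The chain of the n still to be transported, joined by the connector at its largest index to the
    current index N of the other chain. *)
Definition connected_sum (k : seq nat) (i N : nat) : \bar R :=
  nested_sum a k (connector x i N) 0.

Let C_ge0 i N n : 0 <= connector x i N n. Proof. exact: (connector_ge0 xP). Qed.
Let C'_ge0 i N n : 0 <= connector' a x i N n. Proof. exact: (connector'_ge0 xP). Qed.

Lemma connected_sum_ge0 k i N : 0 <= connected_sum k i N.
Proof. exact: nested_sum_ge0. Qed.

Lemma connected_sum_nil i N : (0 < N)%N ->
  connected_sum [::] i N = (N%:R^-1)%:E *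
    (if i is i'.+1 then connected_sum [::] i' N else 1).
Proof.
move=> N0; rewrite {1}/connected_sum/= (connector_parts xP)// mul0e adde0.
by case: i.
Qed.

(** For n > 0 there is no boundary term, and the factor 1/n cancels the n produced by integration by
    parts. *)
Let connector_parts_gt0 N n : (0 < N)%N -> (0 < n)%N -> forall i,
  (n%:R^-1)%:E * connector x i N n = (N%:R^-1)%:E *
    ((if i is i'.+1 then (n%:R^-1)%:E * connector x i' N n else 0)
     + connector' a x i N n.-1).
Proof.
move=> N0 n0 i; rewrite (connector_parts xP)// muleCA; congr (_ * _).
have nN : (n%:R^-1)%:E * (n%:R%:E * connector' a x i N n.-1) = connector' a x i N n.-1.
  by rewrite muleA -EFinM mulVf ?mul1e// pnatr_eq0 -lt0n.
case: i nN => [|i] nN; first by rewrite gt_eqF// add0e nN add0e.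
by rewrite ge0_muleDr ?mule_ge0// nN.
Qed.

Let nested_sum_parts k1 k i N b : (0 < N)%N ->
  nested_sum a (k1 :: k) (fun n => (n%:R^-1)%:E * connector x i N n) b =
  (N%:R^-1)%:E * ((if i is i'.+1 then
     nested_sum a (k1 :: k) (fun n => (n%:R^-1)%:E * connector x i' N n) b else 0)
     + nested_sum a (k1 :: k) (fun n => connector' a x i N n.-1) b).
Proof.
move=> N0; rewrite (eq_nested_sum_gt0 _ _ _ _ (fun n n0 => connector_parts_gt0 N0 n0 i)).
rewrite nested_sumZ ?invr_ge0// => [|n]; last first.
  by case: i => [|i]; rewrite adde_ge0 ?mule_ge0// lee_fin invr_ge0.
congr (_ * _); case: i => [|i].
  by rewrite add0e; apply: eq_nested_sum => n; rewrite add0e.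
by rewrite nested_sumD// => n; rewrite mule_ge0// lee_fin invr_ge0.
Qed.

(** One factor 1/n_1 is traded for 1/N. A positive exponent of n_1 remains, so the chain of the n
    keeps its length, and [step_sum_connector] opens a new index M > N. *)
Lemma connected_sum_S k1 k i N : (0 < N)%N ->
  connected_sum (k1.+2 :: k) i N = (N%:R^-1)%:E *
    ((if i is i'.+1 then connected_sum (k1.+2 :: k) i' N else 0)
     + step_sum a (connected_sum (k1.+1 :: k) i) N).
Proof.
move=> N0; rewrite /connected_sum.
rewrite (nested_sumS _ k1.+1) nested_sum_parts//; congr (_ * (_ + _)).
  by case: i => [//|i]; rewrite (nested_sumS _ k1.+1).
rewrite -nested_sum_step_sum => [|M n]; last exact: C_ge0.
apply: eq_nested_sum_gt0 => -[//|n] _.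
by rewrite (step_sum_connector xP).
Qed.

(** The only factor 1/n_1 is traded for 1/N. With exponent 0 left, [step_sum_connector'] sums n_1
    away and attaches the connector to the next index, or to 0 if there is none; N stays. *)
Lemma connected_sum_1 k i N : (0 < N)%N ->
  connected_sum (1%N :: k) i N = (N%:R^-1)%:E *
    ((if i is i'.+1 then connected_sum (1%N :: k) i' N else 0)
     + connected_sum k i N).
Proof.
move=> N0.
have E g b : nested_sum a (1%N :: k) g b =
    nested_sum a (0%N :: k) (fun n => (n%:R^-1)%:E * g n) b by exact: nested_sumS.
rewrite /connected_sum !E nested_sum_parts//; congr (_ * (_ + _)).
  by case: i => [//|i]; rewrite E.
rewrite /=; apply: eq_nested_sum => n; rewrite -(step_sum_connector' xP).
by apply: eq_step_sum => m _; rewrite expr0 invr1 mul1e.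
Qed.

End connected_sum.

(** * The dual sums *)

Section weighted_sum.
Context {R : realType}.
Local Open Scope ereal_scope.
Implicit Types (m : seq nat) (F G : seq nat -> \bar R).

(** This is the sum over |j| = i of B(m; j) F(m + j), with the entries of j chosen one after the
    other to suit inductions on m; [weighted_sumE] gives the sum over tuples. *)
Fixpoint weighted_sum m (i : nat) F : \bar R :=
  if m is m1 :: m' then
    \sum_(q < i.+1) 'C(m1 + q - 1, q)%:R%:E *
      weighted_sum m' (i - q) (fun s => F ((m1 + q)%N :: s))
  else if i is 0%N then F [::] else 0.

Lemma weighted_sum_ge0 m i F : (forall s, 0 <= F s) -> 0 <= weighted_sum m i F.
Proof.
elim: m i F => [[|i]|m1 m IHm i] F F0 //=.
by apply: sume_ge0 => q _; rewrite mule_ge0// IHm.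
Qed.

Lemma eq_weighted_sum m i F G : (forall s, size s = size m -> F s = G s) ->
  weighted_sum m i F = weighted_sum m i G.
Proof.
elim: m i F G => [[|i]|m1 m IHm i] F G FG //=; first exact: FG.
apply: eq_bigr => q _; congr (_ * _); apply: IHm => s sm.
by apply: FG; rewrite /= sm.
Qed.

Lemma weighted_sumZ m i (c : R) F : (forall s, 0 <= F s) ->
  weighted_sum m i (fun s => c%:E * F s) = c%:E * weighted_sum m i F.
Proof.
elim: m i F => [[|i]|m1 m IHm i] F F0 //=; first by rewrite mule0.
rewrite ge0_sume_distrr => [|q _]; last by rewrite mule_ge0// weighted_sum_ge0.
by apply: eq_bigr => q _; rewrite IHm// muleCA.
Qed.

Lemma weighted_sum_step_sum a m i (F : nat -> seq nat -> \bar R) b :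
  (forall n s, 0 <= F n s) ->
  weighted_sum m i (fun s => step_sum a (F ^~ s) b) =
  step_sum a (fun n => weighted_sum m i (F n)) b.
Proof.
elim: m i F => [[|i]|m1 m IHm i] F F0 //=.
  by rewrite /step_sum eseries0// => d _ _; rewrite mule0.
rewrite /step_sum.
under [RHS]eq_eseriesr => d _.
  rewrite ge0_sume_distrr => [|q _]; last by rewrite mule_ge0// weighted_sum_ge0.
  over.
rewrite nneseries_sum => [|q d _]; last first.
  by rewrite !mule_ge0// weighted_sum_ge0.
apply: eq_bigr => q _.
rewrite (IHm _ (fun n s => F n ((m1 + q)%N :: s)))// -step_sumZ => [|n].
  by apply: eq_eseriesr.
exact: weighted_sum_ge0.
Qed.

Lemma big_tuple_cons (T : finType) n (P : pred (seq T)) (G : seq T -> \bar R) :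
  \sum_(j : n.+1.-tuple T | P j) G j =
  \sum_(q : T) \sum_(j : n.-tuple T | P (q :: j)) G (q :: j).
Proof.
rewrite pair_big_dep/=.
rewrite (reindex (fun p : T * n.-tuple T => [tuple of p.1 :: p.2]))//=.
exists (fun t => (thead t, [tuple of behead t])) => [[q j] _|j _] /=.
  by congr pair; apply: val_inj.
by apply: val_inj; case/tupleP: j.
Qed.

Lemma weighted_sumE K m i F : (i < K)%N -> (forall s, 0 <= F s) ->
  weighted_sum m i F =
  \sum_(j : (size m).-tuple 'I_K | sumn (map val j) == i)
    (compB m (map val j))%:R%:E * F (comp_add m (map val j)).
Proof.
elim: m i F => [|m1 m IHm] i F iK F0 /=.
  case: i iK => [|i] _.
    rewrite (big_pred1 [tuple]) => [|j]; last by rewrite tuple0.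
    by rewrite /compB /comp_add/= big_nil mul1e.
  by rewrite big_pred0// => j; rewrite tuple0.
rewrite (@big_tuple_cons 'I_K _ (fun j => sumn (map val j) == i)
  (fun j => (compB (m1 :: m) (map val j))%:R%:E * F (comp_add (m1 :: m) (map val j)))).
(* The first entry q now ranges over the same ['I_K] as on the right; no tuple with q > i has sum
   i. *)
rewrite (big_ord_widen K (fun q => 'C(m1 + q - 1, q)%:R%:E *
  weighted_sum m (i - q) (fun s => F ((m1 + q)%N :: s))) iK).
rewrite big_mkcond/=; apply: eq_bigr => q _; rewrite ltnS; case: leqP => qi.
  rewrite IHm//; last exact: leq_ltn_trans (leq_subr _ _) iK.
  rewrite ge0_sume_distrr => [|j _]; last by rewrite mule_ge0.
  apply: eq_big => [j|j _]; first by rewrite -(eqn_add2l q) subnKC.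
  by rewrite muleA -EFinM -natrM /compB /= big_cons.
rewrite big_pred0// => j; apply/negbTE; rewrite neq_ltn.
by rewrite (leq_trans qi) ?orbT ?leq_addr.
Qed.

End weighted_sum.

Section dual_sum.
Context {R : realType} (a : nat).
Local Open Scope ereal_scope.

(** Here exponents are listed from the smallest index upwards, opposite to [nested_sum], hence
    [rev]. *)
Definition tail_sum (m : seq nat) (i N : nat) : \bar R :=
  weighted_sum m i (fun s => nested_sum a (rev s) (fun=> 1) N).

(** In contrast to [tail_sum], the smallest index is N itself and only the later ones are summed. *)
Definition dual_sum (m : seq nat) (i N : nat) : \bar R :=
  weighted_sum m i (fun s =>
    (N%:R ^- head 0%N s)%:E * nested_sum a (rev (behead s)) (fun=> 1) N).

Let ns_ge0 k N : 0 <= nested_sum a k (fun=> 1 : \bar R) N.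
Proof. exact: nested_sum_ge0. Qed.

Lemma tail_sum_ge0 m i N : 0 <= tail_sum m i N.
Proof. exact: weighted_sum_ge0. Qed.

Lemma dual_sum_ge0 m i N : 0 <= dual_sum m i N.
Proof. by apply: weighted_sum_ge0 => s; rewrite mule_ge0. Qed.

Lemma step_sum_dual_sum m1 m i N :
  step_sum a (dual_sum (m1 :: m) i) N = tail_sum (m1 :: m) i N.
Proof.
rewrite /dual_sum -weighted_sum_step_sum => [|n s]; last by rewrite mule_ge0.
by apply: eq_weighted_sum => -[//|s1 s] _; rewrite rev_cons nested_sum_rcons.
Qed.

Lemma dual_sum_cons m1 m i N : dual_sum (m1 :: m) i N =
  \sum_(q < i.+1) ('C(m1 + q - 1, q)%:R * N%:R ^- (m1 + q))%:E *
    tail_sum m (i - q) N.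
Proof.
rewrite /dual_sum/=; apply: eq_bigr => q _.
rewrite weighted_sumZ => [|s]; last exact: ns_ge0.
by rewrite muleA -EFinM.
Qed.

(** An exponent 0 receives nothing from j, since C(q - 1, q) = 0 for q > 0; at q = 0 truncated
    subtraction gives C(0, 0) = 1. *)
Lemma dual_sum0 m i N : dual_sum (0%N :: m) i N = tail_sum m i N.
Proof.
rewrite dual_sum_cons big_ord_recl/= subn0 bin0 expr0 invr1 mulr1 mul1e.
rewrite big1 ?adde0// => q _.
by rewrite add0n /bump/= subn1 bin_small ?mul0r ?mul0e.
Qed.

(** Pascal's rule C(m1 + q, q) = C(m1 + q - 1, q - 1) + C(m1 + q - 1, q) for q > 0: the first part
    belongs to i - 1, the second to the exponent m1. The term q = 0 goes wholly to the second. The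
    shape is that of the recurrences for connected sums. *)
Lemma dual_sum_S m1 m i N : (0 < N)%N ->
  dual_sum (m1.+1 :: m) i N = (N%:R^-1)%:E *
    ((if i is i'.+1 then dual_sum (m1.+1 :: m) i' N else 0)
     + dual_sum (m1 :: m) i N).
Proof.
move=> N0.
have NS n : (N%:R ^- n.+1 = N%:R^-1 * N%:R ^- n :> R)%R by rewrite exprS invfM.
have coef_ge0 (c n : nat) : 0 <= (c%:R * N%:R ^- n : R)%:E.
  by rewrite lee_fin mulr_ge0// invr_ge0 exprn_ge0.
have term_ge0 (c n j : nat) : 0 <= (c%:R * N%:R ^- n)%:E * tail_sum m j N.
  by rewrite mule_ge0// tail_sum_ge0.
rewrite ge0_muleDr; last 2 first.
- by case: i => [//|i]; exact: dual_sum_ge0.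
- exact: dual_sum_ge0.
rewrite [dual_sum (m1.+1 :: m) i N]dual_sum_cons [dual_sum (m1 :: m) i N]dual_sum_cons.
rewrite big_ord_recl [in RHS]big_ord_recl/= !bin0 !mul1r !addn0 !subn0.
rewrite ge0_muleDr; [|by rewrite mule_ge0 ?tail_sum_ge0| exact: sume_ge0].
rewrite addeCA muleA -EFinM -NS; congr (_ + _).
have E (q : 'I_i) :
    ('C(m1.+1 + bump 0 q - 1, bump 0 q)%:R * N%:R ^- (m1.+1 + bump 0 q))%:E *
      tail_sum m (i - bump 0 q) N =
    ('C(m1.+1 + q - 1, q)%:R * N%:R ^- (m1.+1 + q.+1))%:E * tail_sum m (i - q.+1) N +
    (N%:R^-1)%:E * (('C(m1 + bump 0 q - 1, bump 0 q)%:R * N%:R ^- (m1 + bump 0 q))%:E *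
      tail_sum m (i - bump 0 q) N).
  rewrite /bump /= add1n muleA -EFinM [in X in _ + X]mulrCA -NS -ge0_muleDl//.
  rewrite -EFinD -mulrDl -natrD; congr ((_ * _)%:E * _); congr _%:R.
  by rewrite !addnS !subn1/= addSn/= binS addnC.
rewrite (eq_bigr _ (fun q _ => E q)) big_split/=; congr (_ + _).
  case: i {E} => [|i]; first by rewrite big_ord0 mule0.
  rewrite dual_sum_cons ge0_sume_distrr//; apply: eq_bigr => q _.
  by rewrite muleA -EFinM [in RHS]mulrCA -NS addnS.
by rewrite ge0_sume_distrr.
Qed.

(** The exponents of the chain of the N, smallest index first. Each of the first k_1 - 1 factors
    1/n_1 leaves an exponent 1 and opens a larger index; the last one stays at its index and raises
    the exponent found there. The empty composition contributes the final 1/N of the connector at n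
    = 0. *)
Fixpoint transport_index (k : seq nat) : seq nat :=
  if k is k1 :: k' then
    nseq k1.-1 1%N ++
      (head 0%N (transport_index k')).+1 :: behead (transport_index k')
  else [:: 1%N].

Lemma transport_index_cons k :
  transport_index k =
    head 0%N (transport_index k) :: behead (transport_index k).
Proof. by case: k => [//|[|[|k1]] k]. Qed.

(** Both sides obey the same recurrences: [connected_sum_nil], [connected_sum_1] and
    [connected_sum_S] match [dual_sum_S] and [dual_sum0]. The inductions are on k, then on its first
    entry, then on i. *)
Lemma connected_sumE (x : R -> R) k i N : dualizing a x ->
  all (fun n => (0 < n)%N) k -> (0 < N)%N ->
  connected_sum a x k i N = dual_sum (transport_index k) i N.
Proof.
move=> xP; elim: k i N => [|[//|k1] k IHk] i N /=.
  move=> _ N0; elim: i => [|i IHi].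
    by rewrite (connected_sum_nil xP)// dual_sum_S// dual_sum0 add0e.
  by rewrite (connected_sum_nil xP)// dual_sum_S// dual_sum0 adde0 IHi.
move=> k_gt0; elim: k1 i N => [|k1 IHk1] i N N0.
  elim: i => [|i IHi]; rewrite (connected_sum_1 xP)// dual_sum_S//=.
    by rewrite -transport_index_cons IHk.
  by rewrite IHi -transport_index_cons IHk.
(* The hypothesis on k1 holds for every M > 0, so it may be used under the sum over M > N. *)
have T j : step_sum a (connected_sum a x (k1.+1 :: k) j) N = tail_sum
    (nseq k1 1%N ++ (head 0%N (transport_index k)).+1 :: behead (transport_index k)) j N.
  rewrite (eq_step_sum _ _ (fun n n0 => IHk1 j n n0)).
  by case: (k1) => [|k1']; rewrite /= step_sum_dual_sum.
elim: i => [|i IHi]; rewrite (connected_sum_S xP)// T /= dual_sum_S// dual_sum0//.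
by rewrite IHi.
Qed.

End dual_sum.

(** * The Hoffman dual *)

Section hoffman_dual_transport.
Local Open Scope nat_scope.

Lemma pairmap_rcons (T U : Type) (f : T -> T -> U) x s y :
  pairmap f x (rcons s y) = rcons (pairmap f x s) (f (last x s) y).
Proof. by rewrite -!cats1 pairmap_cat. Qed.

Lemma iota_rcons m n : iota m n.+1 = rcons (iota m n) (m + n).
Proof. by rewrite -addn1 iotaD cats1. Qed.

Lemma partial_sums_rcons k c :
  partial_sums (rcons k c) = [seq sumn (take j k) | j <- iota 1 (size k)].
Proof.
rewrite /partial_sums size_rcons; apply/eq_in_map => j; rewrite mem_iota => jk.
by rewrite -cats1 takel_cat//; lia.
Qed.

Lemma partial_sums_rcons1 k c : 0 < size k ->
  partial_sums (rcons k c) = rcons (partial_sums k) (sumn k).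
Proof.
rewrite partial_sums_rcons /partial_sums; case: (size k) (take_size k) => // n tk _.
by rewrite iota_rcons map_rcons add1n tk.
Qed.

(** The old weight is not a partial sum of the enlarged composition, so it becomes a partial sum of
    the dual, at distance 1 from the new weight. *)
Lemma hoffman_dual_rconsS k c : is_composition (rcons k c.+1) ->
  hoffman_dual (rcons k c.+2) = rcons (hoffman_dual (rcons k c.+1)) 1.
Proof.
move=> kc; rewrite /hoffman_dual.
have -> : partial_sums (rcons k c.+2) = partial_sums (rcons k c.+1).
  by rewrite !partial_sums_rcons.
have -> : sumn (rcons k c.+2) = (sumn (rcons k c.+1)).+1 by rewrite !sumn_rcons !addnS.
have s_gt0 : 0 < sumn (rcons k c.+1) by rewrite sumn_rcons addnS.
have sN : sumn (rcons k c.+1) \notin partial_sums (rcons k c.+1).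
  by apply/negP => /(mem_partial_sums kc); rewrite ltnn andbF.
rewrite /= -[X in iota 1 X](prednK s_gt0) iota_rcons filter_rcons add1n prednK// sN.
by rewrite [LHS]pairmap_rcons last_rcons subSnn.
Qed.

(** The old weight is a partial sum of the extended composition, so the complement does not change;
    only the end point moves by 1, which lengthens the last entry of the dual. *)
Lemma hoffman_dual_rcons1 k : is_composition k -> exists D e,
  hoffman_dual k = rcons D e /\ hoffman_dual (rcons k 1) = rcons D e.+1.
Proof.
move=> kc; rewrite /hoffman_dual.
have k_gt0 : 0 < size k by case/andP: kc.
have s_gt0 : 0 < sumn k by case: (k) kc => // c k' /andP[_ /= /andP[]]; lia.
rewrite partial_sums_rcons1// sumn_rcons addn1/=.
have -> : iota 1 (sumn k) = rcons (iota 1 (sumn k).-1) (sumn k).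
  by rewrite -[in LHS](prednK s_gt0) iota_rcons add1n prednK.
rewrite filter_rcons mem_rcons inE eqxx/= !pairmap_rcons.
set F := [seq m <- iota 1 (sumn k).-1 | m \notin partial_sums k].
have -> : [seq m <- iota 1 (sumn k).-1 | m \notin rcons (partial_sums k) (sumn k)] = F.
  apply: eq_in_filter => m; rewrite mem_iota => mk.
  by rewrite mem_rcons inE; case: eqP mk => // ->; lia.
(* This keeps the subtraction in the last entry from being truncated. *)
have lastF : last 0 F <= sumn k.
  have := mem_last 0 F; rewrite inE => /predU1P[->//|].
  by rewrite mem_filter mem_iota => /andP[_]; move: (last 0 F) => m; lia.
by exists (pairmap (fun a b => b - a) 0 F), (sumn k - last 0 F); rewrite subSn.
Qed.

Lemma hoffman_dual_rcons_nseq k c : is_composition (rcons k 1) ->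
  hoffman_dual (rcons k c.+1) = hoffman_dual (rcons k 1) ++ nseq c 1.
Proof.
move=> k1; have kc n : is_composition (rcons k n.+1).
  by move: k1; rewrite /is_composition !size_rcons !all_rcons.
elim: c => [|c IHc]; first by rewrite cats0.
by rewrite hoffman_dual_rconsS// IHc -(addn1 c) nseqD catA cats1.
Qed.

(** Putting c + 1 in front of k appends it to the reversal: appending 1 raises the last entry of the
    dual, and c further increments append c ones. After reversal this is one step of
    [transport_index]. *)
Lemma transport_indexE k : is_composition k ->
  transport_index k = rev (comp_plus (hoffman_dual (rev k))).
Proof.
elim: k => [//|[//|c] k IHk] /andP[_ /= k_gt0]; rewrite rev_cons.
have [k0|k_neq0] := eqVneq k [::].
  by rewrite k0 hoffman_dual_rcons_nseq//= rev_cons rev_nseq cats1.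
have kc : is_composition k.
  by rewrite /is_composition k_gt0 andbT lt0n size_eq0.
have rkc : is_composition (rev k) by rewrite /is_composition size_rev all_rev.
rewrite hoffman_dual_rcons_nseq; last first.
  by rewrite /is_composition size_rcons all_rcons all_rev.
(* If D is empty, the entry raised by [comp_plus] is the last entry itself. *)
rewrite (IHk kc); have [[|d D] [e [-> ->]]] := hoffman_dual_rcons1 rkc.
  by rewrite /= rev_cons rev_nseq cats1.
by rewrite /= !rev_cons rev_cat rev_nseq !rev_rcons /= rcons_cat.
Qed.

End hoffman_dual_transport.

(** * Nested sums as unordered sums *)

Section chains.
Local Open Scope classical_set_scope.
Local Open Scope nat_scope.

(** Each entry lies in b + 1 + [a] N_0, where b is the next entry, or 0 after the last one. For [a]
    = 2 the parities therefore alternate and the last entry is odd. *)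
Fixpoint is_chain (a : nat) (n : seq nat) : bool :=
  if n is n1 :: n' then
    [&& head 0 n' < n1, a %| n1 - (head 0 n').+1 & is_chain a n']
  else true.

Definition chain (a r : nat) : set (seq nat) :=
  [set n | size n = r /\ is_chain a n].

Lemma is_chain1 n :
  is_chain 1 n = sorted [rel a b | b < a] n && all (fun i => 0 < i) n.
Proof.
elim: n => [//|n1 [|n2 n] IHn]; first by rewrite /= dvd1n !andbT.
rewrite [LHS]/= -/(is_chain 1 (n2 :: n)) IHn dvd1n /=.
have [/= n21|//] := ltnP n2 n1.
by rewrite (leq_ltn_trans _ n21).
Qed.

Lemma mzv_index_chain r : mzv_index r = chain 1 r.
Proof.
apply/seteqP; split => n /=; rewrite /mzv_index /chain /=.
  by move=> [-> s p]; rewrite is_chain1 s p.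
by rewrite is_chain1 => -[-> /andP[s p]].
Qed.

Lemma is_chain2 n : is_chain 2 n <-> is_chain 1 n /\
  forall i, i < size n -> nth 0 n i = size n - i %[mod 2].
Proof.
elim: n => [|n1 n IHn]; first by split.
have head_mod : (forall i, i < size n -> nth 0 n i = size n - i %[mod 2]) ->
    head 0 n = size n %[mod 2].
  by case: (n) => [//|n2 n'] /(_ 0 isT); rewrite subn0.
have parity : head 0 n < n1 -> head 0 n = size n %[mod 2] ->
    (2 %| n1 - (head 0 n).+1) <-> n1 = (size n).+1 %[mod 2].
  by move=> lt_n e; split; lia.
rewrite /= dvd1n/=; split=> [/and3P[lt_n d /IHn[c1 e]]|[/andP[lt_n c1] e]].
  have := head_mod e; move=> /(parity lt_n)[/(_ d) n1E _].
  split; first by rewrite lt_n.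
  by case=> [_|i]; [rewrite subn0|rewrite ltnS subSS; exact: e].
have e' i : i < size n -> nth 0 n i = size n - i %[mod 2] by move=> ltin; apply: (e i.+1).
rewrite lt_n/=; apply/andP; split; last by apply/IHn.
by apply/(parity lt_n (head_mod e')); have := e 0 isT; rewrite subn0.
Qed.

Lemma mtv_index_chain r : mtv_index r = chain 2 r.
Proof.
rewrite /mtv_index mzv_index_chain; apply/seteqP; split => n /=.
  by move=> [[<- c] e]; split => //; apply/is_chain2.
by move=> [<- /is_chain2[c e]].
Qed.

Lemma chain0 a : chain a 0 = [set [::]].
Proof. by apply/seteqP; split => [n [/size0nil]|n ->]. Qed.

Lemma chainS a r : 0 < a -> set_bij (chain a r `*`` (fun=> [set: nat]))
  (chain a r.+1) (fun p => head 0 p.1 + (a * p.2).+1 :: p.1).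
Proof.
move=> a0; split => [[n d] [/= [<- cn] _]|[n d] [n' d'] _ _ /= [+ nn']|].
- by rewrite /chain/= cn addnS ltnS leq_addr subSS addKn dvdn_mulr.
- by rewrite nn' => /addnI[/eqP]; rewrite eqn_pmul2l// => /eqP->.
- move=> [[]//|n1 n] [/= [nr] /and3P[lt_n /dvdnP[d dE] cn]].
  by exists (n, d) => //=; congr cons; rewrite mulnC -dE addnS; lia.
Qed.

End chains.

Section esum_chain.
Context {R : realType} (a : nat) (a0 : (0 < a)%N).
Local Open Scope ereal_scope.

Lemma mzv_term_ge0 k n : (0 <= mzv_term R k n)%R.
Proof. by apply: prodr_ge0 => p _; rewrite invr_ge0 exprn_ge0. Qed.

(** [chainS] splits off the largest index through its gap d; summing over d turns g into the
    [step_sum] that [nested_sum] hands to the remaining exponents. *)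
Lemma esum_chain (k : seq nat) (g : nat -> \bar R) : (forall n, 0 <= g n) ->
  \esum_(n in chain a (size k))
    ((a%:R ^+ size k * mzv_term R k n)%:E * g (head 0%N n)) =
  nested_sum a k g 0.
Proof.
elim: k g => [|k1 k IHk] g g0 /=.
  by rewrite chain0 esum_set1 /mzv_term !big_nil ?mulr1 ?mul1e.
have Vge0 (m n : nat) : 0 <= (m%:R ^- n : R)%:E.
  by rewrite lee_fin invr_ge0 exprn_ge0.
rewrite -IHk => [|n]; last by apply: step_sum_ge0 => m; rewrite mule_ge0.
pose F (n : seq nat) (d : nat) : \bar R :=
  (a%:R ^+ (size k).+1 * mzv_term R (k1 :: k) (head 0%N n + (a * d).+1 :: n)%N)%:E *
  g (head 0 n + (a * d).+1)%N.
have F0 n d : 0 <= F n d by rewrite mule_ge0// lee_fin mulr_ge0 ?exprn_ge0 ?mzv_term_ge0.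
rewrite (reindex_esum _ _ _ _ (chainS (size k) a0))/=.
rewrite -(@esum_esum _ _ _ _ (fun=> @classical_sets.setT nat) F); last by [].
apply: eq_esum => n _; rewrite -nneseries_esumT//.
rewrite /step_sum -nneseriesZl => [|d _]; last by rewrite !mule_ge0.
apply: eq_eseriesr => d _; rewrite !muleA -!EFinM; congr (_%:E * _).
by rewrite /mzv_term/= big_cons/= exprS; ring.
Qed.

End esum_chain.

(** * The integral *)

Section main_identity.
Context {R : realType} (a : nat) (x : R -> R) (xP : dualizing a x).
Local Open Scope ereal_scope.
Local Open Scope classical_set_scope.
Notation mu := (@lebesgue_measure R).

Let a0 : (0 < a)%N. Proof. by case: xP. Qed.

Let itv_gt0 (t : R) : `]0%R, +oo[ t -> (0 < t)%R.
Proof. by rewrite /= in_itv/= andbT. Qed.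

(** One step maps q^n to at most K q^m with K = [a]/(1 - q^[a]), again geometric. Hence Li and A are
    finite at 0 <= q < 1 and [fine] loses nothing. *)
Lemma nested_sum_geometric_lty (k : seq nat) (q : R) b : (0 <= q < 1)%R ->
  nested_sum a k (fun n => (q ^+ n)%:E) b < +oo.
Proof.
move=> q01; have [q0 q1] := andP q01.
have q1a : (0 < 1 - q ^+ a)%R by rewrite subr_gt0 exprn_ilt1// -lt0n.
elim: k => [|k1 k IHk] /=; first exact: ltry.
pose K : R := (a%:R / (1 - q ^+ a))%R.
have K0 : (0 <= K)%R by rewrite divr_ge0// ltW.
have qn_ge0 n : 0 <= (q ^+ n)%:E by rewrite lee_fin exprn_ge0.
have V_ge0 (n m : nat) : 0 <= (n%:R ^- m : R)%:E.
  by rewrite lee_fin invr_ge0 exprn_ge0.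
apply: (@le_lt_trans _ _ (nested_sum a k (fun n => K%:E * (q ^+ n)%:E) b)).
  apply: le_nested_sum => m; rewrite step_sum_ge0 => [|n]; last by rewrite mule_ge0.
  apply: (@le_trans _ _ (step_sum a (fun n => (1 * q ^+ n)%:E) m)).
    apply: le_step_sum => n n0; rewrite mule_ge0// -EFinM lee_fin/=.
    rewrite ler_wpM2r ?exprn_ge0// invf_le1 ?exprn_gt0 ?ltr0n//.
    by rewrite exprn_ege1// ler1n.
  rewrite step_sum_geometric// -EFinM lee_fin mul1r mulrAC.
  by rewrite ler_wpM2l// exprS ler_piMl ?exprn_ge0// ltW.
rewrite nested_sumZ// lte_mul_pinfty// lee_fin.
Qed.

(** The kernel is the geometric series of [a] e^(-Nt) over N in 1 + [a] N_0, and i! undoes the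
    normalisation in [gamma_kernel]. *)
Lemma integral_connected_sum kk i :
  \int[mu]_(t in `]0%R, +oo[)
    (t ^+ i * (a%:R * expR (- t) / (1 - expR (- t) ^+ a)) *
     fine (nested_sum a kk (fun n => (x t ^+ n)%:E) 0))%:E =
  i`!%:R%:E * step_sum a (connected_sum a x kk i) 0.
Proof.
pose S t := nested_sum a kk (fun n => (x t ^+ n)%:E) 0.
have xn_ge0 (t : R) n : (0 < t)%R -> 0 <= (x t ^+ n)%:E.
  by move=> /ltW/(dualizing_ge0 xP)/andP[? _]; rewrite lee_fin exprn_ge0.
have g_ge0 N (t : R) : (0 < t)%R -> 0 <= (gamma_kernel i N t)%:E.
  by move=> /ltW t0; rewrite lee_fin gamma_kernel_ge0.
have S_ge0 t : (0 < t)%R -> 0 <= S t.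
  by move=> t0; apply: nested_sum_ge0 => n; exact: xn_ge0.
have S_fin t : (0 < t)%R -> (fine (S t))%:E = S t.
  move=> t0; rewrite fineK// ge0_fin_numE ?S_ge0//.
  by apply: nested_sum_geometric_lty; exact: dualizing_ge0 xP _ (ltW t0).
have mg N n : measurable_fun (`]0%R, +oo[ : set R)
    (fun t => (gamma_kernel i N t * x t ^+ n)%:E).
  by apply: continuous_measurable_EFin; exact: (continuous_integrand xP).
have csE N : connected_sum a x kk i N =
    \int[mu]_(t in `]0%R, +oo[) ((gamma_kernel i N t)%:E * S t).
  rewrite /connected_sum /connector.
  have gx_ge0 n t : `]0%R, +oo[ t -> 0 <= (gamma_kernel i N t * x t ^+ n)%:E.
    by move=> /itv_gt0 t0; rewrite EFinM mule_ge0 ?g_ge0 ?xn_ge0.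
  apply: etrans (esym (integral_nested_sum a mu kk 0 (measurable_itv _) gx_ge0 (mg N))) _.
  apply: eq_integral => t /[!inE] /itv_gt0 t0.
  rewrite -nested_sumZ => [|//|n]; last exact: xn_ge0.
    by apply: eq_nested_sum => n; rewrite EFinM.
  by rewrite -lee_fin g_ge0.
have mf N : measurable_fun (`]0%R, +oo[ : set R) (fun t => (gamma_kernel i N t)%:E * S t).
  apply: emeasurable_funM.
    by apply: continuous_measurable_EFin; exact: continuous_gamma_kernel.
  apply: (@emeasurable_nested_sum R a _ _ (`]0%R, +oo[ : set R) kk
    (fun n t => (x t ^+ n)%:E) 0) => [n t /itv_gt0|n].
    exact: xn_ge0.
  by apply: continuous_measurable_EFin; exact: (continuous_dualizingX xP).
have fact_ge0 : 0 <= i`!%:R%:E :> \bar R by [].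
rewrite -step_sumZ => [|N]; last exact: (connected_sum_ge0 xP).
have -> : step_sum a (fun N => i`!%:R%:E * connected_sum a x kk i N) 0 =
    step_sum a (fun N => \int[mu]_(t in `]0%R, +oo[)
      (i`!%:R%:E * ((gamma_kernel i N t)%:E * S t))) 0.
  apply: eq_step_sum => N _; rewrite csE ge0_integralZl_EFin//.
    by move=> t /itv_gt0 t0; rewrite mule_ge0 ?g_ge0 ?S_ge0.
  exact: mf.
apply: etrans _ (@integral_step_sum R a _ _ mu (`]0%R, +oo[ : set R)
  (fun N t => i`!%:R%:E * ((gamma_kernel i N t)%:E * S t)) 0 (measurable_itv _) _ _);
  last 2 first.
- by move=> N t /itv_gt0 t0; rewrite !mule_ge0 ?g_ge0 ?S_ge0.
- by move=> N; apply: measurable_funeM; exact: mf.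
apply: eq_integral => t /[!inE] /itv_gt0 t0.
have e01 : (0 <= expR (- t) < 1)%R by rewrite expR_ge0 -expR0 ltr_expR oppr_lt0.
rewrite -/(S t).
have -> : step_sum a (fun N => i`!%:R%:E * ((gamma_kernel i N t)%:E * S t)) 0 =
    step_sum a (fun N => (fine (S t) * t ^+ i * expR (- t) ^+ N)%:E) 0.
  apply: eq_step_sum => N _; rewrite -(S_fin t t0) -!EFinM; congr EFin.
  by rewrite /gamma_kernel; field; rewrite pnatr_eq0 -lt0n fact_gt0.
by rewrite step_sum_geometric// expr1; congr EFin; ring.
Qed.

(** * Convergence of the sum over N *)

Lemma connected_sum_nil_le i N : (0 < N)%N ->
  connected_sum a x [::] i N <= (N%:R^-1)%:E.
Proof.
move=> N0; have V1 : (N%:R^-1 <= 1 :> R)%R by rewrite invf_le1 ?ltr0n// ler1n.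
have V0 : (0 <= N%:R^-1 :> R)%R by rewrite invr_ge0.
elim: i => [|i IHi]; rewrite (connected_sum_nil xP)//; first by rewrite mule1.
apply: (le_trans (lee_wpmul2l _ IHi)) => //.
by rewrite -EFinM lee_fin ler_piMr.
Qed.

(** The recurrence [connected_sum_1] gains a factor 1/N: the term from k becomes O(N^-2), and the
    term from i - 1 becomes O(N^-3). The constants add up along i. *)
Lemma connected_sum_1_le k :
  (forall i, exists2 K : R, (0 <= K)%R &
    forall N, (0 < N)%N -> connected_sum a x k i N <= (K * N%:R^-1)%:E) ->
  forall i, exists2 K : R, (0 <= K)%R &
    forall N, (0 < N)%N -> connected_sum a x (1%N :: k) i N <= (K * N%:R ^- 2)%:E.
Proof.
move=> kP i; have V1 N : (0 < N)%N -> (N%:R^-1 <= 1 :> R)%R.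
  by move=> N0; rewrite invf_le1 ?ltr0n// ler1n.
have V0 (N : nat) : (0 <= N%:R^-1 :> R)%R by rewrite invr_ge0.
elim: i => [|i [K' K'0 IHi]].
  have [K K0 KP] := kP 0%N; exists K => // N N0.
  rewrite (connected_sum_1 xP)// add0e (le_trans (lee_wpmul2l _ (KP N N0)))//.
  by rewrite -EFinM lee_fin mulrCA expr2 invfM.
have [K K0 KP] := kP i.+1; exists (K' + K)%R => [|N N0]; first exact: addr_ge0.
rewrite (connected_sum_1 xP)// (le_trans (lee_wpmul2l _ (leeD (IHi N N0) (KP N N0))))//.
rewrite -EFinD -EFinM lee_fin expr2 invfM mulrDr mulrDl lerD//.
  by rewrite mulrCA ler_wpM2l// ler_piMl ?V1// mulr_ge0.
by rewrite mulrCA.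
Qed.

Lemma connected_sum_ones_le r i : exists2 K : R, (0 <= K)%R &
  forall N, (0 < N)%N -> connected_sum a x (nseq r.+1 1%N) i N <= (K * N%:R ^- 2)%:E.
Proof.
suff H : forall i, exists2 K : R, (0 <= K)%R & forall N, (0 < N)%N ->
    connected_sum a x (nseq r 1%N) i N <= (K * N%:R^-1)%:E.
  exact: connected_sum_1_le.
elim: r {i} => [|r IHr] i.
  by exists 1%R => // N N0; rewrite mul1r connected_sum_nil_le.
have [K K0 KP] := connected_sum_1_le IHr i; exists K => // N N0.
rewrite (le_trans (KP N N0))// lee_fin ler_wpM2l// expr2 invfM.
by rewrite ler_piMr ?invr_ge0// invf_le1 ?ltr0n// ler1n.
Qed.

Lemma eseries_inv_sqr_le2 : \sum_(0 <= d <oo) (d.+1%:R ^- 2 : R)%:E <= 2%:E.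
Proof.
apply: lime_le.
  by apply: is_cvg_nneseries => n _ _; rewrite lee_fin invr_ge0 exprn_ge0.
apply: nearW => -[|n]; rewrite sumEFin lee_fin; first by rewrite big_nil.
(* The sharper bound 2 - 1/(n + 1) is inductive: with m = n + 1 the slack gained is 1/(m (m +
   1)^2). *)
suff : (\sum_(0 <= d < n.+1) d.+1%:R ^- 2 <= 2 - n.+1%:R^-1 :> R)%R.
  by move=> /le_trans; apply; rewrite gerBl invr_ge0.
elim: n => [|n IHn]; first by rewrite big_nat1 expr1n invr1; lra.
rewrite big_nat_recr//= (le_trans (lerD IHn (lexx _)))//.
have n0 : (0 < n.+1%:R :> R)%R by rewrite ltr0n.
rewrite -[n.+2%:R]natr1; set m := n.+1%:R in n0 *.
rewrite -subr_ge0 (_ : (_ - _ = (m * (m + 1) ^+ 2)^-1)%R).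
  by rewrite invr_ge0 mulr_ge0 ?exprn_ge0 ?addr_ge0.
by field; rewrite !gt_eqF// addr_gt0.
Qed.

Lemma step_sum_connected_sum_lty kk i : is_composition kk ->
  step_sum a (connected_sum a x kk i) 0 < +oo.
Proof.
case: kk => [//|k1 kk] /andP[_ kk_gt0].
have [K K0 KP] := connected_sum_ones_le (size kk) i.
apply: (@le_lt_trans _ _ ((a%:R * K)%:E * 2%:E)); last exact: ltry.
apply: le_trans (lee_wpmul2l _ eseries_inv_sqr_le2); last by rewrite lee_fin mulr_ge0.
rewrite -nneseriesZl => [|d _]; last by rewrite lee_fin invr_ge0 exprn_ge0.
apply: lee_nneseries => [d _ _|d _]; rewrite ?mule_ge0 ?(connected_sum_ge0 xP)//.
rewrite add0n EFinM -muleA lee_wpmul2l//.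
apply: (@le_trans _ _ (connected_sum a x (nseq (size kk).+1 1%N) i (a * d).+1)).
  apply: (@le_nested_sum_ones R a (k1 :: kk)) => // n.
  exact: (connector_ge0 xP).
rewrite (le_trans (KP _ _))// -EFinM lee_fin ler_wpM2l//.
(* The index N = [a] d + 1 is at least d + 1. *)
rewrite lef_pV2 ?posrE ?exprn_gt0// lerXn2r ?nnegrE// ler_nat ltnS.
by rewrite leq_pmull.
Qed.

Lemma transport_index_gt0 k : all (fun n => (0 < n)%N) (transport_index k).
Proof.
elim: k => [//|k1 k]; rewrite {1}transport_index_cons /= all_cat => /andP[_ /= ->].
by rewrite andbT all_nseq orbT.
Qed.

Lemma compB_gt0 (l j : seq nat) : all (fun n => (0 < n)%N) l -> (0 < compB l j)%N.
Proof.
elim: l j => [|l1 l IHl] [|j1 j] /=; rewrite /compB ?big_nil//= => /andP[l1_gt0 l_gt0].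
by rewrite big_cons muln_gt0 (IHl _ l_gt0) andbT bin_gt0/=; lia.
Qed.

Lemma compB_rev (l j : seq nat) : size l = size j ->
  compB (rev l) (rev j) = compB l j.
Proof. by move=> lj; rewrite /compB -rev_zip// big_rev. Qed.

Lemma comp_add_rev (l j : seq nat) : size l = size j ->
  comp_add (rev l) (rev j) = rev (comp_add l j).
Proof. by move=> lj; rewrite /comp_add -rev_zip// map_rev. Qed.

Lemma step_sum_connected_sumE kk k n :
  all (fun m => (0 < m)%N) kk ->
  let l := rev (transport_index kk) in n = size l ->
  step_sum a (connected_sum a x kk k) 0 =
  \sum_(j : n.-tuple 'I_k.+1 | sumn (map val j) == k)
    (compB l (map val j))%:R%:E *
      nested_sum a (comp_add l (map val j)) (fun=> 1) 0.
Proof.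
move=> kk_gt0 l; rewrite size_rev => ->.
have -> : step_sum a (connected_sum a x kk k) 0 =
    step_sum a (dual_sum a (transport_index kk) k) 0.
  by apply: eq_step_sum => N N0; exact: connected_sumE.
rewrite transport_index_cons step_sum_dual_sum -transport_index_cons.
rewrite /tail_sum (@weighted_sumE _ k.+1)//; last first.
  by move=> s; apply: nested_sum_ge0 => m; exact: lee01.
(* Since l reverses [transport_index], the tuples j are reversed along with it. *)
have rev_inv : involutive
    (fun j : (size (transport_index kk)).-tuple 'I_k.+1 => [tuple of rev j]).
  by move=> j; apply: val_inj; rewrite /= revK.
rewrite (reindex_inj (inv_inj rev_inv))/=.
apply: eq_big => [j|j _]; first by rewrite map_rev sumn_rev.
have sj : size (transport_index kk) = size (map val (rev j)).
  by rewrite size_map size_rev size_tuple.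
by rewrite -compB_rev// -comp_add_rev// -map_rev revK.
Qed.

Lemma main_identity kk k n : is_composition kk ->
  let l := comp_plus (hoffman_dual (rev kk)) in n = size l ->
  (k`!%:R^-1 * \int[mu]_(t in `]0, +oo[)
    (t ^+ k * (a%:R * expR (- t) / (1 - expR (- t) ^+ a)) *
     fine (nested_sum a kk (fun n => (x t ^+ n)%:E) 0)) =
  \sum_(j : n.-tuple 'I_k.+1 | sumn (map val j) == k)
    (compB l (map val j))%:R *
      fine (nested_sum a (comp_add l (map val j)) (fun=> 1%:E) 0))%R.
Proof.
move=> kkc l nl; have kk_gt0 : all (fun m => (0 < m)%N) kk by case/andP: kkc.
have lE : l = rev (transport_index kk) by rewrite transport_indexE// revK.
have l_gt0 : all (fun m => (0 < m)%N) l by rewrite lE all_rev transport_index_gt0.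
have := step_sum_connected_sum_lty k kkc.
have := step_sum_connected_sumE k kk_gt0; rewrite -lE => /(_ n nl) sE sfin.
pose M (j : n.-tuple 'I_k.+1) : \bar R :=
  nested_sum a (comp_add l (map val j)) (fun=> 1) 0.
have M0 j : 0 <= M j by apply: nested_sum_ge0 => _; exact: lee01.
(* The coefficient B is at least 1, so each M j is bounded by the finite total. *)
have Mfin (j : n.-tuple 'I_k.+1) : sumn (map val j) == k -> (fine (M j))%:E = M j.
  move=> jk; rewrite fineK// ge0_fin_numE// (le_lt_trans _ sfin)// sE.
  rewrite (bigD1 j)//= -[leLHS]adde0 leeD//.
    by rewrite -[leLHS]mul1e lee_wpmul2r ?M0// lee_fin ler1n compB_gt0.
  by apply: sume_ge0 => j' _; rewrite mule_ge0 ?M0.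
have -> : (\sum_(j : n.-tuple 'I_k.+1 | sumn (map val j) == k)
    (compB l (map val j))%:R * fine (M j))%R =
    fine (step_sum a (connected_sum a x kk k) 0).
  rewrite sE (eq_bigr (fun j : n.-tuple 'I_k.+1 =>
    ((compB l (map val j))%:R * fine (M j))%:E)).
    by rewrite sumEFin.
  by move=> j jk; rewrite EFinM Mfin.
have kn0 : (k`!%:R != 0 :> R)%R by rewrite pnatr_eq0 -lt0n fact_gt0.
rewrite [X in (_ * X)%R]/Rintegral integral_connected_sum fineM//.
  by rewrite mulrA mulVf// mul1r.
by rewrite ge0_fin_numE// step_sum_ge0// => N; exact: (connected_sum_ge0 xP).
Qed.

End main_identity.

(** * The two substitutions and the passage to the series *)

Section instances.
Context {R : realType}.
Local Open Scope classical_set_scope.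
Notation mu := (@lebesgue_measure R).

Let expRN01 (t : R) : 0 < t -> 0 < expR (- t) < 1.
Proof. by move=> t0; rewrite expR_gt0 -[ltRHS]expR0 ltr_expR oppr_lt0. Qed.

Lemma dualizing_xi : dualizing 1 (fun t : R => 1 - expR (- t)).
Proof.
split=> [//||t|t t0|t t0]; first by rewrite oppr0 expR0 subrr.
- rewrite (_ : (fun t => _) = cst 1 - (expR \o (-%R : R -> R))) //.
  by apply: is_derive_eq; rewrite /GRing.scale/= expr1; field.
- by have /andP[e0 e1] := expRN01 t0; rewrite subr_gt0 e1 ltrBlDr ltrDl.
- have /andP[e0 e1] := expRN01 t0; rewrite !expr1; field.
  by rewrite subr_eq0 gt_eqF.
Qed.

Lemma tanh_half (t : R) :
  Defs.tanh (t / 2) = (1 - expR (- t)) / (1 + expR (- t)).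
Proof.
have -> : expR (- t) = expR (- (t / 2)) ^+ 2.
  by rewrite -expRM_natl -mulr_natl; congr expR; field.
rewrite /Defs.tanh /Defs.sinh /Defs.cosh [expR (- _)]expRN.
have y0 := expR_gt0 (t / 2); set y := expR (t / 2) in y0 *.
by field; rewrite !gt_eqF// ?addr_gt0 ?exprn_gt0.
Qed.

(** With u = e^(-t), x = (1 - u)/(1 + u), so x' = 2u/(1 + u)^2 = (1 - x^2)/2 and x'/x = 2u/(1 -
    u^2). *)
Lemma dualizing_psi : dualizing 2 (fun t : R => Defs.tanh (t / 2)).
Proof.
have dE (t : R) : 0 < 1 + expR (- t) by rewrite addr_gt0 ?expR_gt0.
rewrite (_ : (fun t : R => Defs.tanh (t / 2)) =
    fun t => (1 - expR (- t)) / (1 + expR (- t))); last first.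
  by apply/funext => t; rewrite tanh_half.
split=> [//||t|t t0|t t0]; first by rewrite oppr0 expR0 subrr mul0r.
- pose E : R -> R := expR \o -%R.
  have dD : is_derive t 1 (fun u => (1 + E u)^-1) (- (1 + E t) ^- 2 *: - expR (- t)).
    apply: is_deriveV; first by rewrite gt_eqF// dE.
    rewrite (_ : (fun u => 1 + E u) = cst 1 + E)//.
    by apply: is_derive_eq; rewrite add0r /GRing.scale/= mulrN1.
  rewrite (_ : (fun t => _) = (cst 1 - E) * (fun u => (1 + E u)^-1))//.
  apply: is_derive_eq; rewrite /GRing.scale/= !fctE /E/=.
  by field; rewrite gt_eqF// dE.
- have /andP[e0 e1] := expRN01 t0.
  by rewrite divr_gt0 ?subr_gt0 ?dE//= ltr_pdivrMr ?dE// mul1r; lra.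
- have /andP[e0 e1] := expRN01 t0; field.
  by rewrite gt_eqF ?dE//= subr_eq0 gt_eqF// exprn_ilt1 ?ltW.
Qed.

(** The integrand is k! times [gamma_kernel k 1], and the recurrence for the empty composition gives
    the value 1 at N = 1. *)
Lemma GammaS k : Gamma (k.+1%:R : R) = k`!%:R.
Proof.
pose x := (fun t : R => 1 - expR (- t)).
have cs1 i : connected_sum 1 x [::] i 1 = 1%:E.
  elim: i => [|i IHi]; rewrite (connected_sum_nil dualizing_xi)// invr1 mul1e//.
rewrite /Gamma /Rintegral.
have -> : (\int[mu]_(t in `]0%R, +oo[) (t `^ (k.+1%:R - 1) * expR (- t))%:E =
    k`!%:R%:E * connected_sum 1 x [::] k 1)%E.
  rewrite /connected_sum /= /connector -ge0_integralZl_EFin//; last 2 first.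
  - move=> t /=; rewrite in_itv/= andbT expr0 mulr1 lee_fin => /ltW.
    exact: gamma_kernel_ge0.
  - apply: continuous_measurable_EFin.
    exact: (continuous_integrand dualizing_xi).
  apply: eq_integral => t; rewrite inE/= in_itv/= andbT => t0.
  rewrite -EFinM -natr1 addrK powR_mulrn ?ltW// /gamma_kernel expr0 mulr1 expr1.
  by congr EFin; field; rewrite pnatr_eq0 -lt0n fact_gt0.
by rewrite cs1 mule1.
Qed.

Lemma polylogE kk (q : R) :  0 <= q ->
  polylog kk q = fine (nested_sum 1 kk (fun n => (q ^+ n)%:E) 0).
Proof.
move=> q0; rewrite /polylog mzv_index_chain -esum_chain// => [|n].
  congr fine; apply: eq_esum => n _.
  by rewrite expr1n mul1r -EFinM mulrC.
by rewrite lee_fin exprn_ge0.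
Qed.

Lemma mzvE l : mzv R l = fine (nested_sum 1 l (fun=> 1%:E) 0).
Proof.
rewrite /mzv mzv_index_chain -esum_chain//.
by congr fine; apply: eq_esum => n _; rewrite expr1n mul1r mule1.
Qed.

Lemma mtvE l : mtv R l = fine (nested_sum 2 l (fun=> 1%:E) 0).
Proof.
rewrite /mtv mtv_index_chain -esum_chain//.
by congr fine; apply: eq_esum => n _; rewrite mule1.
Qed.

Lemma esumZl (T : choiceType) (D : set T) (c : R) (f : T -> \bar R) :
  0 < c -> (forall i, 0 <= f i)%E ->
  (\esum_(i in D) (c%:E * f i) = c%:E * \esum_(i in D) f i)%E.
Proof.
move=> c0 f0; rewrite /esum -ereal_sup_pZl// image_comp; congr ereal_sup.
by apply: eq_imagel => A [finA _] /=; rewrite ge0_mule_fsumr.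
Qed.

Lemma polyAE kk (q : R) : 0 <= q < 1 ->
  polyA kk q = fine (nested_sum 2 kk (fun n => (q ^+ n)%:E) 0).
Proof.
move=> q01; have [q0 _] := andP q01; rewrite /polyA mtv_index_chain.
have q_ge0 n : (0 <= (q ^+ n)%:E)%E by rewrite lee_fin exprn_ge0.
have c0 : 0 < 2 ^+ size kk :> R by rewrite exprn_gt0.
set X := esum _ _.
have XE : ((2 ^+ size kk)%:E * X = nested_sum 2 kk (fun n => (q ^+ n)%:E) 0)%E.
  rewrite -esum_chain// /X -esumZl//; last first.
    by move=> n; rewrite lee_fin mulr_ge0 ?exprn_ge0 ?mzv_term_ge0.
  by apply: eq_esum => n _; rewrite -!EFinM; congr EFin; ring.
(* Pulling 2^r out of [fine] requires a finite sum, which is where q < 1 enters. *)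
have Xfin : X \is a fin_num.
  have : ((2 ^+ size kk)%:E * X < +oo)%E.
    by rewrite XE; exact: nested_sum_geometric_lty dualizing_psi _ _ _ q01.
  have : (0 <= X)%E.
    by apply: esum_ge0 => n _; rewrite lee_fin mulr_ge0 ?exprn_ge0 ?mzv_term_ge0.
  by case: X {XE} => [//||//] _; rewrite gt0_muley.
by rewrite -XE fineM.
Qed.

End instances.

Theorem corollary2p2 (R : realType) (kk : seq nat) (k : nat)
    (hkk : is_composition kk) :
  let n := ((sumn kk).+1 - size kk)%N in
  let l := comp_plus (hoffman_dual (rev kk)) in
  arakawa_kaneko_xi (k.+1%:R : R) kk =
    \sum_(j : n.-tuple 'I_k.+1 | sumn (map val j) == k)
      (compB l (map val j))%:R * mzv R (comp_add l (map val j))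
  /\
  kaneko_tsumura_psi (k.+1%:R : R) kk =
    \sum_(j : n.-tuple 'I_k.+1 | sumn (map val j) == k)
      (compB l (map val j))%:R * mtv R (comp_add l (map val j)).
Proof.
move=> n l.
have nl : n = size l.
  have rkk : is_composition (rev kk) by rewrite /is_composition size_rev all_rev.
  have <- : size (hoffman_dual (rev kk)) = size l by rewrite /l; case: hoffman_dual.
  by rewrite size_hoffman_dual// sumn_rev size_rev.
have e1 (t : R) : 0 < t -> expR (- t) < 1.
  by move=> t0; rewrite -[ltRHS]expR0 ltr_expR oppr_lt0.
have pow (t : R) : 0 < t -> t `^ (k.+1%:R - 1) = t ^+ k.
  by move=> t0; rewrite -natr1 addrK powR_mulrn// ltW.
split.
- under eq_bigr do rewrite mzvE.
  rewrite -(main_identity dualizing_xi k hkk nl) /arakawa_kaneko_xi GammaS.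
  congr (_ * _); apply: eq_Rintegral => t; rewrite inE/= in_itv/= andbT => t0.
  rewrite pow// polylogE ?subr_ge0 ?ltW ?e1//; congr (_ * _).
  (* It remains to identify e^(-t)/(1 - e^(-t)) with 1/(e^t - 1). *)
  rewrite -mulrA mul1r expr1 expRN; congr (_ * _).
  have e0 := expR_gt0 t; have : 1 < expR t by rewrite expR_gt1.
  by move=> /gt_eqF e; field; rewrite !subr_eq0 e gt_eqF.
- under eq_bigr do rewrite mtvE.
  rewrite -(main_identity dualizing_psi k hkk nl) /kaneko_tsumura_psi GammaS.
  congr (_ * _); apply: eq_Rintegral => t; rewrite inE/= in_itv/= andbT => t0.
  have [_ _ _ /(_ t t0)/andP[x0 x1] _] := @dualizing_psi R.
  rewrite pow// polyAE ?ltW//= -mulrA; congr (_ * _).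
  rewrite mulrC; congr (_ * _).
  (* It remains to identify 2 e^(-t)/(1 - e^(-2t)) with 1/sinh t. *)
  have e0 := expR_gt0 t; rewrite /Defs.sinh expRN.
  have : 1 < expR t by rewrite expR_gt1.
  by move=> e; field; rewrite gt_eqF//= subr_eq0 gt_eqF// exprn_egt1.
Qed.
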